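(* Let $\mathcal M=\langle M,<,+,\dots\rangle$ be a semibounded o-minimal expansion of an ordered group. Let $\{E_b\}_{b\in I}$ be a definable family of relations $E_b\subseteq\prod_{i\in[r]}M^{d_i}$. Then there are $\alpha\in\mathbb R_{>0}$ and elements $m_b\in M_{\ge 0}$ ($b\in I$) such that for every $b\in I$, $Zar^\infty_\alpha(E_b,\mathcal C_{m_b})$ holds, where $\mathcal C_{m}$ denotes the class of all $m$-distant grids.
   Context: ''Definable'' means definable in $\mathcal M$ with parameters; a family $\{E_b\}_{b\in I}$ is definable if $I$ and $\bigcup_{b\in I}\{b\}\times E_b$ are definable. A map $f:X\subseteq M^k\to M^l$ is linear if $f(x+t)-f(x)=f(y+t)-f(y)$ whenever $x,y,x+t,y+t\in X$. A partial endomorphism is a linear map $f:(-c,c)\to M$ with $f(0)=0$. Let $\Lambda$ be the set of all $\emptyset$-definable partial endomorphisms and $\mathcal B$ the collection of all bounded definable sets. The o-minimal expansion $\mathcal M$ of an ordered group is semibounded if every definable set is already definable in $\langle M,<,+,0,\{\lambda\}_{\lambda\in\Lambda},\{B\}_{B\in\mathcal B}\rangle$. For $x=(x_1,\dots,x_n)\in M^n$, $|x|=\max_i|x_i|$. For $m\in M_{\ge0}$, a set $X\subseteq M^n$ is $m$-distant if $|x-y|>m$ for all distinct $x,y\in X$. Grids and Zarankiewicz statements: fix positive integers $r,d_1,\dots,d_r$, $[r]=\{1,\dots,r\}$. A grid is a product $B=B_1\times\dots\times B_r$ with $B_i\subseteq M^{d_i}$; it is finite (infinite) if every $B_i$ is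 finite (infinite), a $k$-grid if $|B_i|=k$ for all $i$, and $m$-distant if every $B_i$ is an $m$-distant set. For a finite grid, $\delta(B)=\sum_{1\le i_1<\dots<i_{r-1}\le r}\prod_{j=1}^{r-1}|B_{i_j}|$. For a relation $E\subseteq\prod_{i\in[r]}M^{d_i}$ and a class $\mathcal C$ of grids: $E$ has linear Zarankiewicz bounds for $\mathcal C$ witnessed by $\alpha\in\mathbb R_{>0}$ if $|E\cap B|\le\alpha\,\delta(B)$ for every finite $B\in\mathcal C$; $E$ is $\mathcal C$-$\infty$-free if it contains no infinite grid belonging to $\mathcal C$. $Zar^\infty_\alpha(E,\mathcal C)$ is the statement: if $E$ is $\mathcal C$-$\infty$-free, then $E$ has linear Zarankiewicz bounds for $\mathcal C$ witnessed by $\alpha$. *)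

(* Defs.v *)
From Stdlib Require Import Reals.
From HB Require Import structures.
From mathcomp Require Import all_boot all_order all_algebra.
Set Implicit Arguments. Unset Strict Implicit. Unset Printing Implicit Defensive.
Import Order.TTheory GRing.Theory Num.Theory.
Local Open Scope ring_scope.

Definition ordered_group (M : porderZmodType) : Prop :=
  (forall x y : M, (x <= y) || (y <= x)) /\
  (forall x y z : M, x < y -> x + z < y + z).

Section Defs.
Variable M : porderZmodType.

Definition getn n (x : 'I_n -> M) (j : nat) : M :=
  match (insub j : option 'I_n) with Some o => x o | None => 0 end.

(* First-order formulas in a relational language whose symbols are    *)
(* the relations themselves (a relation of arity n is a subset of M^n).*)
Inductive fml : Type :=
| FRel (n : nat) (R : ('I_n -> M) -> Prop) (args : 'I_n -> nat)
| FEq (i j : nat)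
| FNot (f : fml)
| FAnd (f g : fml)
| FEx (i : nat) (f : fml).

Definition upd (v : nat -> M) (i : nat) (a : M) : nat -> M :=
  fun j => if j == i then a else v j.

Fixpoint sat (v : nat -> M) (f : fml) : Prop :=
  match f with
  | FRel n R args => R (fun k => v (args k))
  | FEq i j => v i = v j
  | FNot g => ~ sat v g
  | FAnd g h => sat v g /\ sat v h
  | FEx i g => exists a, sat (upd v i a) g
  end.

Fixpoint wf (P : forall n, (('I_n -> M) -> Prop) -> Prop) (f : fml) : Prop :=
  match f with
  | FRel n R _ => P n R
  | FEq _ _ => True
  | FNot g => wf P g
  | FAnd g h => wf P g /\ wf P h
  | FEx _ g => wf P g
  end.

Fixpoint fv_in (b : nat -> bool) (f : fml) : Prop :=
  match f with
  | FRel n _ args => forall k, b (args k)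
  | FEq i j => b i && b j
  | FNot g => fv_in b g
  | FAnd g h => fv_in b g /\ fv_in b h
  | FEx i g => fv_in (fun j => (j == i) || b j) g
  end.

Definition ext n (x : 'I_n -> M) (p : nat -> M) : nat -> M :=
  fun j => match (insub j : option 'I_n) with Some o => x o | None => p j end.

Definition definable (P : forall n, (('I_n -> M) -> Prop) -> Prop) n
    (X : ('I_n -> M) -> Prop) : Prop :=
  exists f, wf P f /\ exists p : nat -> M, forall x, X x <-> sat (ext x p) f.

Definition definable0 (P : forall n, (('I_n -> M) -> Prop) -> Prop) n
    (X : ('I_n -> M) -> Prop) : Prop :=
  exists f, wf P f /\ fv_in (fun j => (j < n)%N) f /\
    forall x, X x <-> sat (ext x (fun _ => 0)) f.

Definition absg (a : M) : M := if a < 0 then - a else a.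
Definition normv n (x : 'I_n -> M) : M :=
  foldr Order.max 0 [seq absg (x j) | j <- enum 'I_n].
Definition subv n (x y : 'I_n -> M) : 'I_n -> M := fun j => x j - y j.

Definition lt_rel n (R : ('I_n -> M) -> Prop) : Prop :=
  n = 2%N /\ forall x, R x <-> getn x 0 < getn x 1.
Definition add_rel n (R : ('I_n -> M) -> Prop) : Prop :=
  n = 3%N /\ forall x, R x <-> getn x 0 + getn x 1 = getn x 2.
Definition zero_rel n (R : ('I_n -> M) -> Prop) : Prop :=
  n = 1%N /\ forall x, R x <-> getn x 0 = 0.

Definition expansion_of_ordered_group (P : forall n, (('I_n -> M) -> Prop) -> Prop) :=
  ordered_group M /\ (forall n R, lt_rel R -> P n R) /\
  (forall n R, add_rel R -> P n R) /\ (forall n R, zero_rel R -> P n R).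

(* o-minimality: every definable subset of M is a finite union of points and open
   intervals (a,b) with a, b in M ∪ {-oo,+oo} (None = infinite endpoint) *)
Definition in_open_itv (ab : option M * option M) (x : M) : bool :=
  (if ab.1 is Some a then a < x else true) && (if ab.2 is Some b then x < b else true).

Definition o_minimal (P : forall n, (('I_n -> M) -> Prop) -> Prop) : Prop :=
  forall X : M -> Prop, definable P (fun x : 'I_1 -> M => X (getn x 0)) ->
    exists (pts : seq M) (itvs : seq (option M * option M)),
      forall a, X a <-> (has (fun p => a == p) pts || has (fun ab => in_open_itv ab a) itvs).

(* partial endomorphisms f : (-c,c) -> M, with c in M_{>0} or c = +oo (None) *)
Definition in_dom (c : option M) (a : M) : Prop :=
  if c is Some c then - c < a /\ a < c else True.

Definition partial_endo (c : option M) (f : M -> M) : Prop :=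
  (if c is Some c then 0 < c else True) /\ f 0 = 0 /\
  forall x y t, in_dom c x -> in_dom c y -> in_dom c (x + t) -> in_dom c (y + t) ->
    f (x + t) - f x = f (y + t) - f y.

Definition Lambda (P : forall n, (('I_n -> M) -> Prop) -> Prop) n
    (R : ('I_n -> M) -> Prop) : Prop :=
  n = 2%N /\ definable0 P R /\
  exists (c : option M) (f : M -> M), partial_endo c f /\
    forall x, R x <-> (in_dom c (getn x 0) /\ getn x 1 = f (getn x 0)).

Definition bounded n (X : ('I_n -> M) -> Prop) : Prop :=
  exists m : M, forall x, X x -> normv x <= m.

Definition semibounded_reduct (P : forall n, (('I_n -> M) -> Prop) -> Prop) n
    (R : ('I_n -> M) -> Prop) : Prop :=
  lt_rel R \/ add_rel R \/ zero_rel R \/ Lambda P R \/ (bounded R /\ definable P R).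

Definition semibounded (P : forall n, (('I_n -> M) -> Prop) -> Prop) : Prop :=
  forall n (X : ('I_n -> M) -> Prop), definable P X -> definable (semibounded_reduct P) X.

(* Grids.  A point of prod_{i in [r]} M^{d_i} is a flat vector in M^D,
   D = sum_i d_i; block i occupies coordinates off_i, ..., off_i + d_i - 1. *)
Definition Dsum r (d : 'I_r -> nat) : nat := (\sum_(i < r) d i)%N.
Definition off r (d : 'I_r -> nat) (i : 'I_r) : nat := (\sum_(j < r | (j < i)%N) d j)%N.
Definition blk r (d : 'I_r -> nat) (z : 'I_(Dsum d) -> M) (i : 'I_r) : 'I_(d i) -> M :=
  fun k => getn z (off d i + k).
Arguments blk {r d} z i.

Definition m_distant n (m : M) (X : ('I_n -> M) -> Prop) : Prop :=
  forall x y, X x -> X y -> x <> y -> m < normv (subv x y).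

Definition finite_set (T : Type) (X : T -> Prop) : Prop :=
  exists n (s : 'I_n -> T), forall x, X x <-> exists j, s j = x.

(* delta(B) for a finite grid with |B_i| = n_i *)
Definition delta r (n : 'I_r -> nat) : nat :=
  (\sum_(S : {set 'I_r} | #|S| == r.-1) \prod_(j in S) n j)%N.

(* E has linear Zarankiewicz bounds for m-distant grids, witnessed by alpha.
   A finite grid B = B_1 x ... x B_r is given by injective enumerations
   s i : 'I_(n i) -> M^{d_i} of B_i (so |B_i| = n i);
   "|E ∩ B| <= alpha * delta(B)" is stated as: every injective list of N points of
   E ∩ B has N <= alpha * delta(B). *)
Definition linear_Zar_bounds r (d : 'I_r -> nat) (E : ('I_(Dsum d) -> M) -> Prop)
    (m : M) (alpha : R) : Prop :=
  forall (n : 'I_r -> nat) (s : forall i, 'I_(n i) -> ('I_(d i) -> M)),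
    (forall i, injective (s i)) ->
    (forall i, m_distant m (fun x => exists j, s i j = x)) ->
    forall N (pts : 'I_N -> ('I_(Dsum d) -> M)), injective pts ->
      (forall a, E (pts a) /\ forall i : 'I_r, exists j, blk (pts a) i = s i j) ->
      Rle (INR N) (Rmult alpha (INR (delta n))).

Definition inf_free r (d : 'I_r -> nat) (E : ('I_(Dsum d) -> M) -> Prop) (m : M) : Prop :=
  ~ exists B : forall i, ('I_(d i) -> M) -> Prop,
      (forall i, ~ finite_set (B i)) /\ (forall i, m_distant m (B i)) /\
      (forall z, (forall i : 'I_r, B i (blk z i)) -> E z).

Definition Zar_inf r (d : 'I_r -> nat) (E : ('I_(Dsum d) -> M) -> Prop)
    (alpha : R) (m : M) : Prop :=
  inf_free E m -> linear_Zar_bounds E m alpha.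

Definition definable_family (P : forall n, (('I_n -> M) -> Prop) -> Prop) k r
    (d : 'I_r -> nat) (I : ('I_k -> M) -> Prop)
    (E : ('I_k -> M) -> ('I_(Dsum d) -> M) -> Prop) : Prop :=
  definable P I /\
  definable P (fun w : 'I_(k + Dsum d) -> M =>
     I (fun j => w (lshift (Dsum d) j)) /\
     E (fun j => w (lshift (Dsum d) j)) (fun j => w (rshift k j))).

End Defs.

(* Main.v *)
(* Every definable set is determined by finitely many linear forms h (over the
   division ring of definable endomorphisms of M), each known only up to
   truncation to an interval [-m, m].  This is quantifier elimination: the class
   of such sets contains the half-spaces and all bounded sets, and is closed
   under projection by a back-and-forth argument.

   Fix a relation E_b and sort its points by the side of [-m, m] on which each
   form lies; this gives at most 3^|H| pieces, uniformly in b.  If on some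
   nonempty piece the forms that take values in [-m, m] have a common zero line
   in each block M^{d_i}, small moves along these lines give an infinite grid in
   E_b.  So if E_b contains no infinite grid, every piece has a block i on which
   these forms have trivial common kernel; its fibres in that block are then
   bounded by a constant m*, so they meet an m*-distant set in at most one
   point, and |E_b /\ B| <= 3^|H| delta(B).  If E_b does contain an infinite
   grid, m_b = 0 makes the statement vacuous. *)

Require Import Defs.
From Stdlib Require Import Reals Classical ClassicalEpsilon FunctionalExtensionality.
From HB Require Import structures.
From mathcomp Require Import all_boot all_order all_algebra.
From mathcomp Require Import zify.
Set Implicit Arguments. Unset Strict Implicit. Unset Printing Implicit Defensive.
Import Order.TTheory GRing.Theory Num.Theory.
Local Open Scope ring_scope.

(** * Deciding identities in abelian groups by reflection *)

Section AbelianGroupIdentities.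
Variable V : zmodType.

Inductive zexp := ZVar of nat | ZZero | ZAdd of zexp & zexp | ZOpp of zexp.

Fixpoint zeval (env : seq V) e : V :=
  match e with
  | ZVar i => env`_i
  | ZZero => 0
  | ZAdd e1 e2 => zeval env e1 + zeval env e2
  | ZOpp e1 => - zeval env e1
  end.

Fixpoint zcoef e (i : nat) : int :=
  match e with
  | ZVar j => (i == j)%:Z
  | ZZero => 0
  | ZAdd e1 e2 => zcoef e1 i + zcoef e2 i
  | ZOpp e1 => - zcoef e1 i
  end.

Lemma zevalE env e : zeval env e = \sum_(i < size env) env`_i *~ zcoef e i.
Proof.
elim: e => /= [j||e1 -> e2 ->|e1 ->].
- have [lt_j|ge_j] := ltnP j (size env).
    rewrite (bigD1 (Ordinal lt_j)) //= eqxx mulr1z big1 ?addr0 // => i.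
    by rewrite -val_eqE /= => /negbTE ->; rewrite mulr0z.
  rewrite nth_default // big1 // => i _.
  by rewrite (ltn_eqF (leq_trans (ltn_ord i) ge_j)) mulr0z.
- by rewrite big1 // => i _; rewrite mulr0z.
- by rewrite -big_split /=; apply: eq_bigr => i _; rewrite mulrzDr.
- by rewrite -sumrN; apply: eq_bigr => i _; rewrite mulrNz.
Qed.

(** The value of an expression depends only on its integer coefficients. Variables beyond the
    environment evaluate to [0], so only the listed ones are compared. *)
Lemma zexp_eq env e1 e2 :
  all (fun i => zcoef e1 i == zcoef e2 i) (iota 0 (size env)) ->
  zeval env e1 = zeval env e2.
Proof.
move=> /allP eq12; rewrite !zevalE; apply: eq_bigr => i _.
by rewrite (eqP (eq12 _ _)) // mem_iota /=.
Qed.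

End AbelianGroupIdentities.

Ltac zmem x s :=
  lazymatch s with
  | nil => constr:(false)
  | cons ?y ?s' =>
    match y with x => constr:(true) | _ => zmem x s' end
  end.
Ltac zatoms t s :=
  lazymatch t with
  | (?a + ?b)%R => let s' := zatoms a s in zatoms b s'
  | (- ?a)%R => zatoms a s
  | 0%R => s
  | _ => let b := zmem t s in
         lazymatch b with true => s | false => constr:(cons t s) end
  end.
Ltac zindex x s :=
  lazymatch s with
  | cons ?y ?s' =>
    match y with
    | x => constr:(0%N)
    | _ => let n := zindex x s' in constr:(S n)
    end
  end.
Ltac zreify t s :=
  lazymatch t with
  | (?a + ?b)%R =>
    let a' := zreify a s in let b' := zreify b s in constr:(ZAdd a' b')
  | (- ?a)%R => let a' := zreify a s in constr:(ZOpp a')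
  | 0%R => constr:(ZZero)
  | _ => let n := zindex t s in constr:(ZVar n)
  end.
Ltac abel :=
  lazymatch goal with
  | |- @eq ?T ?x ?y =>
    let s := zatoms x (@nil T) in
    let s := zatoms y s in
    let ex := zreify x s in
    let ey := zreify y s in
    change (zeval s ex = zeval s ey);
    apply: zexp_eq; vm_compute; reflexivity
  end.

(** * Ordered groups and tame subsets *)

Section OrderedGroup.
Variable M : porderZmodType.
Hypothesis og : ordered_group M.
Implicit Types (x y z m a b : M) (X Y : M -> Prop).

Lemma lt_or_le x y : x < y \/ y <= x.
Proof.
have [/orP[le_xy|]] := og.1 x y; last by right.
have [->|ne] := eqVneq x y; first by right.
by left; rewrite lt_neqAle ne.
Qed.

Lemma le_not_lt x y : x <= y -> ~ y < x.
Proof. by move=> le_xy lt_yx; have := le_lt_trans le_xy lt_yx; rewrite ltxx. Qed.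

Lemma ltD x y z t : x < y -> z < t -> x + z < y + t.
Proof.
move=> lt_xy lt_zt; apply: (lt_trans (og.2 _ _ z lt_xy)).
by rewrite ![y + _]addrC; exact: og.2.
Qed.

Lemma leD_same x y z : x <= y -> x + z <= y + z.
Proof. by rewrite le_eqVlt => /predU1P[-> //|lt_xy]; exact: ltW (og.2 _ _ _ lt_xy). Qed.

Lemma leD x y z t : x <= y -> z <= t -> x + z <= y + t.
Proof.
move=> le_xy le_zt; apply: (le_trans (leD_same z le_xy)).
by rewrite ![y + _]addrC; exact: leD_same.
Qed.

Lemma leltD x y z t : x <= y -> z < t -> x + z < y + t.
Proof.
move=> le_xy lt_zt; apply: (le_lt_trans (leD_same z le_xy)).
by rewrite ![y + _]addrC; exact: og.2.
Qed.

(** Linear inequalities are derived below by transporting a known one along an equality of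
    differences, which [abel] decides. *)
Lemma lt_by a b x y : a < b -> y - x = b - a -> x < y.
Proof.
move=> lt_ab eq; have := og.2 _ _ (x - a) lt_ab.
have -> : b + (x - a) = y by rewrite addrCA -eq subrKC.
by rewrite subrKC.
Qed.

Lemma le_by a b x y : a <= b -> y - x = b - a -> x <= y.
Proof.
move=> le_ab eq; have := leD_same (x - a) le_ab.
have -> : b + (x - a) = y by rewrite addrCA -eq subrKC.
by rewrite subrKC.
Qed.

Definition within m x := - m <= x /\ x <= m.

Lemma within_le m n x : m <= n -> within m x -> within n x.
Proof.
move=> le_mn [ge_x le_x]; split; last exact: le_trans le_mn.
by apply: le_trans ge_x; apply: (le_by le_mn); abel.
Qed.

Lemma withinD m n x y : within m x -> within n y -> within (m + n) (x + y).
Proof.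
by move=> [x1 x2] [y1 y2]; split; [apply: (le_by (leD x1 y1))|apply: (le_by (leD x2 y2))]; abel.
Qed.

Lemma withinN m x : within m x -> within m (- x).
Proof. by move=> [x1 x2]; split; [apply: (le_by x2)|apply: (le_by x1)]; abel. Qed.

Lemma within_cases m x : m < x \/ x < - m \/ within m x.
Proof.
have [|le_x] := lt_or_le m x; first by left.
have [|ge_x] := lt_or_le x (- m); first by right; left.
by right; right.
Qed.

Lemma ex_ge2 x y : exists2 z, x <= z & y <= z.
Proof. by have /orP[] := og.1 x y => le; [exists y|exists x]. Qed.

Lemma ex_pos_le2 x y : 0 < x -> 0 < y -> exists2 z, 0 < z & z <= x /\ z <= y.
Proof. by have /orP[] := og.1 x y => le x_gt0 y_gt0; [exists x|exists y]. Qed.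

Lemma ex_ge0_within x : exists2 m, 0 <= m & within m x.
Proof.
have [le0x|lex0] := orP (og.1 0 x).
  by exists x => //; split=> //; apply: (le_by (leD le0x le0x)); abel.
exists (- x); first by apply: (le_by lex0); abel.
by split; [rewrite opprK|apply: (le_by (leD lex0 lex0)); abel].
Qed.

(** By upward monotonicity, one upper bound of finitely many thresholds serves for all of them. *)
Lemma ex_uniform (T : finType) (Q : T -> M -> Prop) :
  (forall (t : T) m m', m <= m' -> Q t m -> Q t m') -> (forall t : T, exists m, Q t m) ->
  exists2 m, 0 <= m & forall t : T, Q t m.
Proof.
move=> monQ exQ.
suff [m m_ge0 Qm] : exists2 m, 0 <= m & forall t : T, t \in enum T -> Q t m.
  by exists m => // t; apply: Qm; rewrite mem_enum.
elim: (enum T) => [|t s [m m_ge0 Qm]]; first by exists 0.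
have [m1 Qm1] := exQ t; have [n le_m le_m1] := ex_ge2 m m1.
exists n => [|u]; first exact: le_trans le_m.
by rewrite inE => /predU1P[->|/Qm]; [exact: monQ Qm1|exact: monQ].
Qed.

Definition tame X := exists pts itvs,
  forall a, X a <-> (has (fun p => a == p) pts || has (fun ab => in_open_itv ab a) itvs).

(** A tame set is a finite union, built here one point or interval at a time. The first premise
    replaces set extensionality. *)
Lemma tame_ind (T : (M -> Prop) -> Prop) :
  (forall X Y, (forall x, X x <-> Y x) -> T X -> T Y) ->
  T (fun _ => False) -> (forall p, T (fun x => x = p)) ->
  (forall ab, T (in_open_itv ab)) ->
  (forall X Y, T X -> T Y -> T (fun x => X x \/ Y x)) ->
  forall X, tame X -> T X.
Proof.
move=> Text T0 Tp Ti TU X [pts [itvs defX]].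
apply: (Text (fun x => has (fun p => x == p) pts \/ has (fun ab => in_open_itv ab x) itvs)).
  by move=> x; rewrite defX; split=> /orP.
apply: (TU _ _ _ _).
  elim: pts {defX} => [|p s IHs] /=; first by apply: Text T0.
  apply: Text (TU _ _ (Tp p) IHs) => x.
  by split=> [[->|->]|/predU1P[]]; rewrite ?eqxx ?orbT //; [left|right].
elim: itvs {defX} => [|ab s IHs] /=; first by apply: Text T0.
by apply: Text (TU _ _ (Ti ab) IHs) => x; split=> /orP.
Qed.

Lemma tame_opp X : tame X -> tame (fun x => X (- x)).
Proof.
pose op := omap (fun x : M => - x).
move=> [pts [itvs defX]].
exists [seq - p | p <- pts], [seq (op ab.2, op ab.1) | ab <- itvs] => a.
rewrite defX !has_map; set b1 := (b in is_true b <-> _); set b2 := (b in _ <-> is_true b).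
suff -> : b1 = b2 by []; rewrite /b1 /b2.
congr (_ || _); apply: eq_has; first by move=> p /=; rewrite eqr_oppLR.
move=> [[l|] [u|]]; rewrite /in_open_itv /= ?andbT //; rewrite 1?andbC.
- by congr (_ && _); apply/idP/idP => lt; apply: (lt_by lt); abel.
- by apply/idP/idP => lt; apply: (lt_by lt); abel.
- by apply/idP/idP => lt; apply: (lt_by lt); abel.
Qed.

(** The order need not be complete, but points and intervals have suprema in [M], and the larger of
    two suprema serves for a union. *)
Lemma tame_sup X x0 u : tame X -> X x0 -> (forall x, X x -> x <= u) ->
  exists2 s, (forall x, X x -> x <= s) & forall t, t < s -> exists2 x, X x & t < x.
Proof.
move=> tX; pose bdd Y := exists u, forall x, Y x -> x <= u.
pose hassup Y := exists2 s, (forall x, Y x -> x <= s) & forall t, t < s -> exists2 x, Y x & t < x.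
(* Nonemptiness and boundedness move into the predicate, so that the induction over tame sets can
   vary them. *)
suff: (exists x, X x) -> bdd X -> hassup X by move=> sup Xx0 leu; apply: sup; [exists x0|exists u].
move: X tX; apply: tame_ind.
- move=> X Y eXY IH [x /eXY Xx] [w lew].
  have [] := IH; [by exists x| by exists w => y /eXY /lew|].
  move=> s les ltS; exists s => [y /eXY /les //|t /ltS[y /eXY]]; by exists y.
- by case.
- by move=> p _ _; exists p => [x -> //|t ltp]; exists p.
- move=> [l [b|]] [x0' x0in] [w lew].
    (* Density of the order is not known yet, so some [w'] below [b] might bound the interval. It
       would then lie in the interval and be its maximum. *)
    case: (classic (exists2 w', w' < b & forall x, in_open_itv (l, Some b) x -> x <= w')).
      move=> [w' ltw'b lew']; exists w' => // t ltt; exists w' => //.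
      move: x0in (lew' _ x0in); rewrite /in_open_itv /= ltw'b andbT => /andP[ltl _].
      by case: l ltl {lew lew'} => // l; exact: lt_le_trans.
    move=> nob; exists b => [x /andP[_ /ltW] //|t ltt]; apply: NNPP => not_t.
    apply: nob; exists t => // x xin; case: (lt_or_le t x) => // ltx.
    by case: not_t; exists x.
  exists w => // t lttw; case: l x0in lew => [l|] /= x0in lew.
    suff lt_lw : l < w by exists w; rewrite // /in_open_itv /= lt_lw.
    by apply: lt_le_trans (lew _ x0in); case/andP: x0in.
  by exists w.
- move=> X Y IX IY neXY [w lew].
  have bX : bdd X by exists w => x Xx; apply: lew; left.
  have bY : bdd Y by exists w => x Xx; apply: lew; right.
  case: (classic (exists x, X x)) => [/IX/(_ bX)[s les lts]|noX]; last first.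
    have {}neXY : exists x, Y x by case: neXY => x [Xx|Yx]; [case: noX; exists x|exists x].
    have [s les lts] := IY neXY bY; exists s => [x [] Xx|t /lts[x Yx ltx]]; first by case: noX; exists x.
      exact: les.
    by exists x => //; right.
  case: (classic (exists x, Y x)) => [/IY/(_ bY)[s' les' lts']|noY]; last first.
    exists s => [x [/les //|Yx]|t /lts[x Xx ltx]]; first by case: noY; exists x.
    by exists x => //; left.
  case: (lt_or_le s s') => [/ltW|] le.
    exists s' => [x [/les /le_trans-> //|/les' //]|t /lts'[x]]; by exists x => //; right.
  exists s => [x [/les //|/les' /le_trans-> //]|t /lts[x]]; by exists x => //; left.
Qed.

Lemma tame_inf X x0 u : tame X -> X x0 -> (forall x, X x -> u <= x) ->
  exists2 s, (forall x, X x -> s <= x) & forall t, s < t -> exists2 x, X x & x < t.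
Proof.
move=> /tame_opp tX Xx0 geu.
have [||s les lts] := @tame_sup _ (- x0) (- u) tX; first by rewrite opprK.
  by move=> x /geu le; apply: (le_by le); abel.
exists (- s) => [x|t lt].
  by rewrite -{1}[x]opprK => /les le; apply: (le_by le); abel.
have [|x Xx ltx] := lts (- t); first by apply: (lt_by lt); abel.
by exists (- x) => //; apply: (lt_by ltx); abel.
Qed.

Lemma tame_at_infty X : tame X ->
  exists N, (forall x, N < x -> X x) \/ (forall x, N < x -> ~ X x).
Proof.
move: X; apply: tame_ind.
- by move=> X Y eXY [N [] H]; exists N; [left|right] => x /H; rewrite eXY.
- by exists 0; right => x _ [].
- by move=> p; exists p; right => x ltp eqx; rewrite eqx ltxx in ltp.
- move=> [l [b|]].
    exists b; right => x ltb /andP[_ /= ltx].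
    by have := lt_trans ltb ltx; rewrite ltxx.
  case: l => [l|]; last by exists 0; left.
  by exists l; left => x ltx; rewrite /in_open_itv /= ltx.
- move=> X Y [N H] [N' H']; have [K leN leN'] := ex_ge2 N N'; exists K.
  case: H => H; first by left=> x ltx; left; apply: H; exact: le_lt_trans ltx.
  case: H' => H'; first by left=> x ltx; right; apply: H'; exact: le_lt_trans ltx.
  by right=> x ltx [/H|/H']; apply; exact: le_lt_trans ltx.
Qed.

(** Membership is constant between [0] and the least positive point or endpoint; [e0] serves when
    there is none. *)
Lemma tame_at_0 X (e0 : M) : 0 < e0 -> tame X ->
  exists2 e : M, 0 < e & (forall x, 0 < x -> x < e -> X x) \/
    (forall x, 0 < x -> x < e -> ~ X x).
Proof.
move=> e0_gt0; move: X; apply: tame_ind.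
- by move=> X Y eXY [e e_gt0 [] H]; exists e => //; [left|right] => x x_gt0 /(H _ x_gt0); rewrite eXY.
- by exists e0 => //; right => x _ _ [].
- move=> p; case: (lt_or_le 0 p) => p0; [exists p => //|exists e0 => //]; right=> x x_gt0 ltx eqx.
    by rewrite eqx ltxx in ltx.
  by have := le_lt_trans p0 x_gt0; rewrite eqx ltxx.
- move=> [l b].
  have Hb : exists2 e : M, 0 < e & forall x, 0 < x -> x < e ->
      (if b is Some b then x < b else true) = (if b is Some b then 0 < b else true).
    case: b => [b|]; last by exists e0.
    case: (lt_or_le 0 b) => b0; [exists b => // x _ ->|exists e0 => // x x_gt0 _]; first by rewrite b0.
    apply/idP/idP => lt; first by case: (le_not_lt b0); exact: lt_trans lt.
    by case: (le_not_lt b0).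
  have Hl : exists2 e : M, 0 < e & forall x, 0 < x -> x < e ->
      (if l is Some l then l < x else true) = (if l is Some l then l <= 0 else true).
    case: l => [l|]; last by exists e0.
    case: (lt_or_le 0 l) => l0; [exists l => // x x_gt0 ltx|exists e0 => // x x_gt0 _].
      by apply/idP/idP => lt; [case: (le_not_lt (ltW ltx))|case: (le_not_lt lt)].
    by rewrite l0; exact: le_lt_trans x_gt0.
  have [e e_gt0 He] := Hb; have [e' e'_gt0 He'] := Hl.
  have [e2 e2_gt0 [le1 le2]] := ex_pos_le2 e_gt0 e'_gt0.
  exists e2 => //.
  case Ec: ((if l is Some l then l <= 0 else true) && (if b is Some b then 0 < b else true)).
    left=> x x_gt0 ltx; rewrite /in_open_itv /= He ?He' //; first [exact: lt_le_trans le1|exact: lt_le_trans le2].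
  right=> x x_gt0 ltx; rewrite /in_open_itv /= He ?He' ?Ec //; first [exact: lt_le_trans le1|exact: lt_le_trans le2].
- move=> X Y [e e_gt0 H] [e' e'_gt0 H'].
  have [e2 e2_gt0 [le1 le2]] := ex_pos_le2 e_gt0 e'_gt0.
  exists e2 => //.
  case: H => H; first by left=> x x_gt0 ltx; left; apply: H => //; exact: lt_le_trans le1.
  case: H' => H'; first by left=> x x_gt0 ltx; right; apply: H' => //; exact: lt_le_trans le2.
  by right=> x x_gt0 ltx [/H|/H']; apply=> //; [exact: lt_le_trans le1|exact: lt_le_trans le2].
Qed.

(** If [X] were bounded with supremum [s], an element above [s - x0] plus [x0] would exceed [s]. An
    unbounded tame set contains a ray. *)
Lemma tame_ray X x0 : tame X -> X x0 -> (forall x, X x -> 0 < x) ->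
  (forall x y, X x -> X y -> X (x + y)) -> exists N, forall x, N < x -> X x.
Proof.
move=> tX Xx0 posX addX.
have unb u : exists2 x, X x & u < x.
  apply: NNPP => nox.
  have [|s les lts] := @tame_sup _ x0 u tX Xx0.
    by move=> x Xx; case: (lt_or_le u x) => // lt; case: nox; exists x.
  have [|x Xx ltx] := lts (s - x0); first by apply: (lt_by (posX _ Xx0)); abel.
  have := les _ (addX _ _ Xx Xx0) => /le_not_lt; apply.
  by apply: (lt_by ltx); abel.
have [N [H|H]] := tame_at_infty tX; first by exists N.
by have [x Xx ltx] := unb N; case: (H x).
Qed.

(** If [X] avoided an interval to the right of [0], its infimum [s] would be positive, and halving
    an element below [s + s] would lead below [s]. *)
Lemma tame_halving X x0 : tame X -> X x0 -> (forall x, X x -> 0 < x) ->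
  (forall x, X x -> exists2 y, X y & y + y = x) ->
  exists2 e : M, 0 < e & forall x, 0 < x -> x < e -> X x.
Proof.
move=> tX Xx0 posX halfX.
have [e e_gt0 [H|H]] := tame_at_0 (posX _ Xx0) tX; first by exists e.
have geX x : X x -> e <= x.
  by move=> Xx; case: (lt_or_le x e) => // lt; case: (H x) => //; exact: posX.
have [s ges lts] := @tame_inf _ x0 e tX Xx0 geX.
have s_gt0 : 0 < s.
  case: (lt_or_le 0 s) => // s0.
  have [x /geX le] := lts e (le_lt_trans s0 e_gt0).
  by move/(le_not_lt le).
have [|x Xx ltx] := lts (s + s); first by apply: (lt_by s_gt0); abel.
have [y Xy eqx] := halfX _ Xx; subst x.
by have := ges _ Xy => le; case: (le_not_lt (leD le le)).
Qed.

(** * Definable predicates on valuations *)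

Variable P : forall n, (('I_n -> M) -> Prop) -> Prop.
Hypothesis P_lt : forall n (R : ('I_n -> M) -> Prop), lt_rel R -> P R.
Hypothesis P_add : forall n (R : ('I_n -> M) -> Prop), add_rel R -> P R.
Hypothesis P_omin : o_minimal P.

Fixpoint rename (rho : nat -> nat) (f : fml M) : fml M :=
  match f with
  | FRel n R args => FRel R (fun k => rho (args k))
  | FEq i j => FEq M (rho i) (rho j)
  | FNot g => FNot (rename rho g)
  | FAnd g h => FAnd (rename rho g) (rename rho h)
  | FEx i g => FEx (rho i) (rename rho g)
  end.

Lemma wf_rename rho f : wf P f -> wf P (rename rho f).
Proof. by elim: f => //= f IHf g IHg [/IHf ? /IHg ?]. Qed.

Lemma sat_rename rho f v : injective rho ->
  sat v (rename rho f) <-> sat (fun j => v (rho j)) f.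
Proof.
move=> inj_rho; elim: f v => //= [f IHf|f IHf g IHg|i f IHf] v.
- by rewrite IHf.
- by rewrite IHf IHg.
suff eq_upd a : (fun j => upd v (rho i) a (rho j)) = upd (fun j => v (rho j)) i a.
  by split=> -[a]; [rewrite IHf eq_upd|rewrite -eq_upd -IHf]; exists a.
by apply: functional_extensionality => j; rewrite /upd (inj_eq inj_rho).
Qed.

(* Even indices carry the variables and odd indices the parameters, so that two
   formulas can be given disjoint parameters by an injective renaming. *)
Definition interleave (v p : nat -> M) : nat -> M :=
  fun j => if odd j then p j./2 else v j./2.

(** Stating definability for predicates on whole valuations avoids tracking arities when formulas
    are combined or quantified. *)
Definition vdef (S : (nat -> M) -> Prop) : Prop :=
  exists2 f, wf P f & exists p, forall v, S v <-> sat (interleave v p) f.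

Lemma interleave_even v p i : interleave v p i.*2 = v i.
Proof. by rewrite /interleave odd_double doubleK. Qed.

Lemma interleave_odd v p i : interleave v p i.*2.+1 = p i.
Proof. by rewrite /interleave /= odd_double /= uphalf_double. Qed.

Lemma interleave_upd v p i a : upd (interleave v p) i.*2 a = interleave (upd v i a) p.
Proof.
apply: functional_extensionality => j; rewrite /upd /interleave.
have [->|ne] := eqVneq j i.*2; first by rewrite odd_double doubleK eqxx.
case: ifP => // oddj; case: eqP => // eqj.
by move: ne; rewrite -eqj -[j in j == _]odd_double_half oddj eqxx.
Qed.

Lemma vdef_ext S S' : (forall v, S v <-> S' v) -> vdef S -> vdef S'.
Proof. by move=> eqS [f wff [p defS]]; exists f => //; exists p => v; rewrite -eqS. Qed.

Lemma vdef_and S S' : vdef S -> vdef S' -> vdef (fun v => S v /\ S' v).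
Proof.
move=> [f wff [p defS]] [g wfg [q defS']].
(* [rho b] fixes the variables and sends parameter number [i] to number [2i + b]. The merged
   parameters [pq] thus contain [p] and [q] side by side. *)
pose rho (b : bool) j := if odd j then (j./2.*2 + b).*2.+1 else j.
have inj_rho (b : bool) : injective (rho b).
  move=> i j; rewrite /rho.
  have := odd_double_half i; have := odd_double_half j; case: b.
    by case: (odd i); case: (odd j); lia.
  by case: (odd i); case: (odd j); lia.
exists (FAnd (rename (rho false) f) (rename (rho true) g)).
  by split; exact: wf_rename.
pose pq := interleave p q; exists pq => v /=.
rewrite defS defS' (sat_rename _ _ (@inj_rho false)) (sat_rename _ _ (@inj_rho true)).
have e1 : (fun j => interleave v pq (rho false j)) = interleave v p.
  apply: functional_extensionality => j; rewrite /rho; case: ifP => oddj; last first.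
    by rewrite /interleave oddj.
  by rewrite interleave_odd addn0 /pq interleave_even /interleave oddj.
have e2 : (fun j => interleave v pq (rho true j)) = interleave v q.
  apply: functional_extensionality => j; rewrite /rho; case: ifP => oddj; last first.
    by rewrite /interleave oddj.
  by rewrite interleave_odd addn1 /pq interleave_odd /interleave oddj.
by rewrite e1 e2.
Qed.

Lemma vdef_ex i S : vdef S -> vdef (fun v => exists a, S (upd v i a)).
Proof.
move=> [f wff [p defS]]; exists (FEx i.*2 f) => //; exists p => v /=.
by split=> -[a Sa]; exists a; move: Sa; rewrite defS interleave_upd.
Qed.

Lemma vdef_rename rho S : injective rho -> vdef S -> vdef (fun v => S (fun j => v (rho j))).
Proof.
move=> inj_rho [f wff [p defS]].
pose sig j := if odd j then j else (rho j./2).*2.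
have inj_sig : injective sig.
  move=> i j; rewrite /sig.
  have := odd_double_half i; have := odd_double_half j.
  case: (odd i); case: (odd j); [lia|lia|lia|] => <- <- /double_inj /inj_rho.
  by rewrite !add0n !doubleK => ->.
exists (rename sig f); first exact: wf_rename.
exists p => v; rewrite defS (sat_rename _ _ inj_sig).
have -> // : (fun j => interleave v p (sig j)) = interleave (fun j => v (rho j)) p.
apply: functional_extensionality => j; rewrite /sig {2}/interleave; case: ifP => oddj.
  by rewrite /interleave oddj.
by rewrite interleave_even.
Qed.

Lemma vdef_lt i j : vdef (fun v => v i < v j).
Proof.
exists (FRel (fun x : 'I_2 -> M => getn x 0 < getn x 1)
          (fun k => (if k == 0 :> nat then i else j).*2)); first exact: P_lt.
exists (fun=> 0) => v /=.
by rewrite /getn; do 2![case: insubP => //= ? _ ->]; rewrite /= !interleave_even.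
Qed.

Lemma vdef_add i j k : vdef (fun v => v i + v j = v k).
Proof.
exists (FRel (fun x : 'I_3 -> M => getn x 0 + getn x 1 = getn x 2)
   (fun l => (if l == 0 :> nat then i else if l == 1 :> nat then j else k).*2)).
  exact: P_add.
exists (fun=> 0) => v /=.
by rewrite /getn; do 3![case: insubP => //= ? _ ->]; rewrite /= !interleave_even.
Qed.

Lemma vdef_eq i j : vdef (fun v => v i = v j).
Proof. by exists (FEq M i.*2 j.*2) => //; exists (fun=> 0) => v; rewrite /= !interleave_even. Qed.

Lemma vdef_const i a : vdef (fun v => v i = a).
Proof.
exists (FEq M i.*2 1) => //; exists (fun=> a) => v /=.
by rewrite interleave_even -[1%N]/(0.*2.+1) interleave_odd.
Qed.

Lemma upd_same v i a : upd v i a i = a.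
Proof. by rewrite /upd eqxx. Qed.

Lemma upd_other v i j a : j != i -> upd v i a j = v j.
Proof. by rewrite /upd => /negbTE ->. Qed.

Lemma vdef_gt i a : vdef (fun v => a < v i).
Proof.
apply: vdef_ext (vdef_ex i.+1 (vdef_and (vdef_const i.+1 a) (vdef_lt i.+1 i))) => v.
have ne : i != i.+1 by rewrite ltn_eqF.
split=> [[b [eqb]]|lt]; first by rewrite eqb upd_other.
by exists a; rewrite upd_same upd_other.
Qed.

Lemma vdef_ltc i a : vdef (fun v => v i < a).
Proof.
apply: vdef_ext (vdef_ex i.+1 (vdef_and (vdef_const i.+1 a) (vdef_lt i i.+1))) => v.
have ne : i != i.+1 by rewrite ltn_eqF.
split=> [[b [eqb]]|lt]; first by rewrite eqb upd_other.
by exists a; rewrite upd_same upd_other.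
Qed.

Lemma vdef_definable n (R : ('I_n -> M) -> Prop) :
  definable P R -> vdef (fun v => R (fun k => v k)).
Proof.
move=> [f [wff [p defR]]].
(* In [ext], the indices from [n] on carry parameters; these go to odd indices and the variables to
   even ones. *)
pose rho j := if (j < n)%N then j.*2 else j.*2.+1.
have inj_rho : injective rho by move=> i j; rewrite /rho; case: ifP; case: ifP; lia.
exists (rename rho f); first exact: wf_rename.
exists p => v; rewrite defR (sat_rename _ _ inj_rho).
have -> // : (fun j => interleave v p (rho j)) = ext (fun k : 'I_n => v k) p.
apply: functional_extensionality => j; rewrite /rho /ext.
by case: insubP => [k -> <-|/negbTE ->]; rewrite ?interleave_even ?interleave_odd.
Qed.

Lemma vdef_tame (X : M -> Prop) : vdef (fun v => X (v 0%N)) -> tame X.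
Proof.
move=> [f wff [p defX]]; apply: P_omin; exists f; split=> //.
exists (interleave (fun=> 0) p) => x.
have -> : ext x (interleave (fun=> 0) p) = interleave (upd (fun=> 0) 0 (getn x 0)) p.
  rewrite -interleave_upd; apply: functional_extensionality => -[|j]; rewrite /ext /upd /getn double0.
    by rewrite eqxx; case: insubP.
  by case: insubP.
by rewrite -defX upd_same.
Qed.

(** O-minimality is applied to full and partial endomorphisms through sets of this shape, with [G] a
    graph or an inverse graph and [Q] a condition on the second coordinate. *)
Lemma tame_dom (G : M -> M -> Prop) (Q : M -> Prop) :
  vdef (fun v => G (v 0%N) (v 1%N)) -> vdef (fun v => Q (v 1%N)) ->
  tame (fun x => 0 < x /\ exists2 y, G x y & Q y).
Proof.
move=> defG defQ; apply: vdef_tame.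
apply: vdef_ext (vdef_and (vdef_gt 0 0) (vdef_ex 1 (vdef_and defG defQ))) => v.
by split=> -[x_gt0 [y]]; [case=> Gy Qy|move=> Gy Qy]; split=> //; exists y.
Qed.

(** * Definable endomorphisms *)

Definition endo (f : M -> M) : Prop :=
  (forall x y, f (x + y) = f x + f y) /\ vdef (fun v => v 1%N = f (v 0%N)).

Lemma addxx_eq0 x : x + x = 0 -> x = 0.
Proof.
move=> eq0; case: (lt_or_le 0 x) => [lt|].
  by have := ltD lt lt; rewrite eq0 addr0 ltxx.
rewrite le_eqVlt => /predU1P[//|lt].
by have := ltD lt lt; rewrite eq0 addr0 ltxx.
Qed.

Lemma neq0_ex_pos x : x != 0 -> exists2 e : M, 0 < e & e = x \/ e = - x.
Proof.
move=> ne; case: (lt_or_le 0 x) => [lt|le]; first by exists x => //; left.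
exists (- x); last by right.
have lt : x < 0 by rewrite lt_neqAle ne.
by apply: (lt_by lt); abel.
Qed.

(** Every element is a difference of two elements beyond [N]. *)
Lemma ray_subgroup X (N e : M) : 0 < e -> (forall x, N < x -> X x) ->
  (forall x y, X x -> X y -> X (x - y)) -> forall x, X x.
Proof.
move=> e_gt0 rayX subX x.
have [t leN leNx] := ex_ge2 N (N - x).
rewrite (_ : x = (x + (t + e)) - (t + e)); last by abel.
by apply: subX; apply: rayX; [apply: (lt_by (leltD leNx e_gt0))|apply: (lt_by (leltD leN e_gt0))]; abel.
Qed.

Lemma endo_0 f : endo f -> f 0 = 0.
Proof. by case=> addf _; apply: (addrI (f 0)); rewrite -addf !addr0. Qed.

Lemma endoN f x : endo f -> f (- x) = - f x.
Proof.
move=> ef; apply/eqP; rewrite -addr_eq0; apply/eqP.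
by rewrite -ef.1 addrC subrr endo_0.
Qed.

Lemma endoB f x y : endo f -> f (x - y) = f x - f y.
Proof. by move=> ef; rewrite ef.1 endoN. Qed.

Lemma endo_at f i j : endo f -> i != j -> vdef (fun v => v j = f (v i)).
Proof.
move=> [_ deff] neij.
(* Any injection with [0] sent to [i] and [1] to [j] will do, since the graph reads no other
   variable. *)
pose rho k := if k == 0%N then i else if k == 1%N then j else (i + j + k)%N.
have inj_rho : injective rho by rewrite /rho => -[|[|k]] [|[|l]] /=; move: neij; lia.
exact: (vdef_rename inj_rho deff).
Qed.

Lemma endo_cst0 : endo (fun=> 0).
Proof. by split=> [x y|]; rewrite ?addr0 //; exact: vdef_const. Qed.

Lemma endo_id : endo id.
Proof. by split=> //; exact: vdef_eq. Qed.

Lemma endo_add f g : endo f -> endo g -> endo (fun x => f x + g x).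
Proof.
move=> ef eg; split=> [x y|]; first by rewrite ef.1 eg.1 addrACA.
apply: vdef_ext (vdef_ex 2 (vdef_ex 3 (vdef_and (vdef_add 2 3 1)
  (vdef_and (@endo_at f 0 2 ef isT) (@endo_at g 0 3 eg isT))))) => v.
split=> [[a [b]]|eqv]; first by rewrite /upd /= => -[<- [-> ->]].
by exists (f (v 0%N)), (g (v 0%N)); rewrite /upd.
Qed.

Lemma endo_comp f g : endo f -> endo g -> endo (fun x => f (g x)).
Proof.
move=> ef eg; split=> [x y|]; first by rewrite eg.1 ef.1.
apply: vdef_ext (vdef_ex 2 (vdef_and (@endo_at g 0 2 eg isT) (@endo_at f 2 1 ef isT))) => v.
split=> [[a]|eqv]; first by rewrite /upd /= => -[<- ->].
by exists (g (v 0%N)); rewrite /upd.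
Qed.

Lemma endo_opp f : endo f -> endo (fun x => - f x).
Proof.
move=> ef; split=> [x y|]; first by rewrite ef.1 opprD.
apply: vdef_ext (vdef_ex 2 (vdef_ex 3 (vdef_and (vdef_add 1 2 3)
  (vdef_and (@endo_at f 0 2 ef isT) (vdef_const 3 0))))) => v.
split=> [[a [b]]|eqv]; first by rewrite /upd /= => -[<- [-> /eqP]]; rewrite addr_eq0 => /eqP.
by exists (f (v 0%N)), 0; rewrite /upd /= eqv addNr.
Qed.

(** The kernel is a definable subgroup. Its positive part is closed under addition, so it contains a
    ray as soon as it is nonempty, and the kernel is then everything. *)
Lemma endo_eq0 f a : endo f -> f a = 0 -> a != 0 -> forall x, f x = 0.
Proof.
move=> ef fa0 /neq0_ex_pos[e e_gt0 eqe].
have fe0 : f e = 0 by case: eqe => ->; rewrite ?endoN // fa0 oppr0.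
have [|||N rayX] := @tame_ray _ e (@tame_dom (fun x y => y = f x) (fun y => y = 0) ef.2 (vdef_const 1 0)).
- by split=> //; exists (f e).
- by move=> x [].
- move=> x y [x_gt0 [_ -> fx0]] [y_gt0 [_ -> fy0]]; split; first by rewrite -[0]addr0 ltD.
  by exists (f (x + y)); rewrite ?ef.1 ?fx0 ?fy0 ?addr0.
apply: (ray_subgroup e_gt0 (N := N)) => [x /rayX[_ [_ ->]] //|x y].
by rewrite endoB // => -> ->; rewrite subr0.
Qed.

(** The same ray argument, applied to the image. *)
Lemma endo_surj f a : endo f -> f a != 0 -> forall y, exists x, f x = y.
Proof.
move=> ef /neq0_ex_pos[e e_gt0 eqe].
have [b fb] : exists b, f b = e by case: eqe => ->; [exists a|exists (- a); rewrite endoN].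
have defim : vdef (fun v => v 0%N = f (v 1%N)) by exact: endo_at.
have [|||N rayX] := @tame_ray _ e (@tame_dom (fun x y => x = f y) (fun y => y = y) defim (vdef_eq 1 1)).
- by split=> //; exists b.
- by move=> x [].
- move=> x y [x_gt0 [x' eqx _]] [y_gt0 [y' eqy _]]; split; first by rewrite -[0]addr0 ltD.
  by exists (x' + y'); rewrite ?ef.1 ?eqx ?eqy.
apply: (ray_subgroup e_gt0 (N := N)) => [x /rayX[_ [x' -> _]]|_ _ [x <-] [y <-]].
  by exists x'.
by exists (x - y); rewrite endoB.
Qed.

(** If both signs occurred on positive elements, the positive elements of each sign would contain a
    ray, and two rays meet. *)
Lemma endo_sign f : endo f ->
  (forall x, f x = 0) \/ (forall x, 0 < x -> 0 < f x) \/ (forall x, 0 < x -> f x < 0).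
Proof.
move=> ef; case: (classic (exists2 a, a != 0 & f a = 0)) => [[a nea fa0]|inj].
  by left; exact: endo_eq0 fa0 nea.
right; have nef0 x : 0 < x -> f x != 0.
  by move=> x_gt0; apply/eqP => fx0; case: inj; exists x => //; rewrite gt_eqF.
case: (classic (exists2 a, 0 < a & 0 < f a)) => [[a a_gt0 fa_gt0]|nopos]; last first.
  right=> x x_gt0; case: (lt_or_le 0 (f x)) => [lt|]; first by case: nopos; exists x.
  by rewrite lt_neqAle nef0.
left=> b b_gt0; case: (lt_or_le 0 (f b)) => // le.
have {le} fb_lt0 : f b < 0 by rewrite lt_neqAle nef0.
have [|||N ray1] := @tame_ray _ a (@tame_dom (fun x y => y = f x) (fun y => 0 < y) ef.2 (vdef_gt 1 0)).
- by split=> //; exists (f a).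
- by move=> x [].
- move=> x y [x_gt0 [_ -> fx]] [y_gt0 [_ -> fy]]; split; first by rewrite -[0]addr0 ltD.
  by exists (f (x + y)); rewrite ?ef.1 // -[0]addr0 ltD.
have [|||N' ray2] := @tame_ray _ b (@tame_dom (fun x y => y = f x) (fun y => y < 0) ef.2 (vdef_ltc 1 0)).
- by split=> //; exists (f b).
- by move=> x [].
- move=> x y [x_gt0 [_ -> fx]] [y_gt0 [_ -> fy]]; split; first by rewrite -[0]addr0 ltD.
  by exists (f (x + y)); rewrite ?ef.1 // -[0]addr0 ltD.
have [K leN leN'] := ex_ge2 N N'.
have ltK : K < K + a by apply: (lt_by a_gt0); abel.
have [_ [_ -> pos]] := ray1 _ (le_lt_trans leN ltK).
have [_ [_ -> neg]] := ray2 _ (le_lt_trans leN' ltK).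
by have := lt_trans pos neg; rewrite ltxx.
Qed.

(** A nonzero endomorphism is injective and surjective, so the definable endomorphisms form a
    division ring. *)
Lemma endo_inv f a : endo f -> f a != 0 ->
  exists2 g, endo g & (forall x, f (g x) = x) /\ (forall x, g (f x) = x).
Proof.
move=> ef nefa; have surj := endo_surj ef nefa.
have inj x y : f x = f y -> x = y.
  move=> eqf; apply/eqP; rewrite -subr_eq0; apply/negPn/negP => ne.
  have f0 : f (x - y) = 0 by rewrite endoB // eqf subrr.
  by rewrite (endo_eq0 ef f0 ne) eqxx in nefa.
pose g y := proj1_sig (constructive_indefinite_description _ (surj y)).
have fg y : f (g y) = y by rewrite /g; case: constructive_indefinite_description.
exists g; last by split=> // x; apply: inj; rewrite fg.
split=> [x y|]; first by apply: inj; rewrite ef.1 !fg.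
(* The graph of [g] is that of [f] with the variables exchanged, so the pointwise choice of [g] is
   definable. *)
apply: vdef_ext (@endo_at f 1 0 ef isT) => v.
by split=> [->|->]; [apply: inj|]; rewrite fg.
Qed.

(** Doubling is an endomorphism, nonzero because an ordered group is torsion-free; hence it is
    surjective. *)
Lemma ex_half x : exists y, y + y = x.
Proof.
have [->|ne] := eqVneq x 0; first by exists 0; rewrite addr0.
have e2 := endo_add endo_id endo_id.
by apply: (endo_surj e2 (a := x)); apply/eqP => /addxx_eq0 /eqP; rewrite (negbTE ne).
Qed.

Lemma half_gt0 x y : y + y = x -> 0 < x -> 0 < y.
Proof.
move=> <- lt; case: (lt_or_le 0 y) => // le.
by case: (le_not_lt (leD le le)); rewrite addr0.
Qed.

Lemma half_lt x y : y + y = x -> 0 < x -> y < x.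
Proof. by move=> eqx /(half_gt0 eqx) lt; rewrite -eqx; apply: (lt_by lt); abel. Qed.

Lemma ex_between x y : x < y -> exists2 z, x < z & z < y.
Proof.
move=> lt; have [h eqh] := ex_half (y - x).
have d_gt0 : 0 < y - x by apply: (lt_by lt); abel.
exists (x + h); first by apply: (lt_by (half_gt0 eqh d_gt0)); abel.
by apply: (lt_by (half_lt eqh d_gt0)); abel.
Qed.

(** By the constant sign on positive elements [f] is monotone, so its values at the ends of the
    interval bound the image. *)
Lemma endo_within f m : endo f ->
  exists2 m', 0 <= m' & forall x, within m x -> within m' (f x).
Proof.
move=> ef; have [m' m'_ge0 [fm1 fm2]] := ex_ge0_within (f m).
exists m' => // x [x1 x2].
have x1' : 0 <= x + m by apply: (le_by x1); abel.
have x2' : 0 <= m - x by apply: (le_by x2); abel.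
have [f0|[fpos|fneg]] := endo_sign ef.
- by rewrite f0; split=> //; apply: (le_by m'_ge0); abel.
- have fge0 z : 0 <= z -> 0 <= f z.
    by rewrite le_eqVlt => /predU1P[<-|/fpos /ltW //]; rewrite endo_0.
  have := fge0 _ x1'; have := fge0 _ x2'; rewrite endoB // ef.1 => h2 h1.
  by split; [apply: (le_by (leD h1 fm2))|apply: (le_by (leD h2 fm2))]; abel.
- have fle0 z : 0 <= z -> f z <= 0.
    by rewrite le_eqVlt => /predU1P[<-|/fneg /ltW //]; rewrite endo_0.
  have := fle0 _ x1'; have := fle0 _ x2'; rewrite endoB // ef.1 => h2 h1.
  by split; [apply: (le_by (leD h2 fm1))|apply: (le_by (leD h1 fm1))]; abel.
Qed.

(** Continuity at [0]: unless [f] is zero, [del] is a preimage of [e] or [- e], according to the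
    sign of [f], and monotonicity does the rest. *)
Lemma endo_small f e : endo f -> 0 < e ->
  exists2 del : M, 0 < del & forall x, 0 < x -> x < del -> - e < f x /\ f x < e.
Proof.
move=> ef e_gt0.
have ne_lt0 : - e < 0 by apply: (lt_by e_gt0); abel.
have [f0|fsign] := endo_sign ef; first by exists e => // x _ _; rewrite f0.
have nefe : f e != 0.
  by case: fsign => /(_ _ e_gt0) lt; [rewrite gt_eqF|rewrite lt_eqF].
have surj := endo_surj ef nefe.
case: fsign => sgn; [have [del eqd] := surj e|have [del eqd] := surj (- e)].
- have d_gt0 : 0 < del.
    case: (lt_or_le 0 del) => //; rewrite le_eqVlt => /predU1P[d0|lt].
      by rewrite d0 endo_0 // in eqd; rewrite -eqd ltxx in e_gt0.
    have nd : 0 < - del by apply: (lt_by lt); abel.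
    have := sgn _ nd; rewrite endoN // eqd => h.
    by have := lt_trans h ne_lt0; rewrite ltxx.
  exists del => // x x_gt0 ltx; have dx : 0 < del - x by apply: (lt_by ltx); abel.
  split; first exact: lt_trans (sgn _ x_gt0).
  by have := sgn _ dx; rewrite endoB // eqd => h; apply: (lt_by h); abel.
- have d_gt0 : 0 < del.
    case: (lt_or_le 0 del) => //; rewrite le_eqVlt => /predU1P[d0|lt].
      by rewrite d0 endo_0 // in eqd; rewrite -eqd ltxx in ne_lt0.
    have nd : 0 < - del by apply: (lt_by lt); abel.
    have := sgn _ nd; rewrite endoN // eqd opprK => h.
    by have := lt_trans h e_gt0; rewrite ltxx.
  exists del => // x x_gt0 ltx; have dx : 0 < del - x by apply: (lt_by ltx); abel.
  split; last exact: lt_trans (sgn _ x_gt0) e_gt0.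
  by have := sgn _ dx; rewrite endoB // eqd => h; apply: (lt_by h); abel.
Qed.

(** Makes the graph of a partial endomorphism on a bounded interval a bounded set. The signs of [f]
    on positive arguments persist under halving, hence down to [0]; so only one strict sign occurs
    there, and [f] is monotone. *)
Lemma partial_endo_bounded c f : partial_endo (Some c) f ->
  vdef (fun v => in_dom (Some c) (v 0%N) /\ v 1%N = f (v 0%N)) ->
  exists m, forall x, in_dom (Some c) x -> within m (f x).
Proof.
move=> [c_gt0 [f0 linf]] deff.
have dom0 : in_dom (Some c) 0.
  by split=> //; apply: (lt_by c_gt0); abel.
have dom_pos x : 0 < x -> x < c -> in_dom (Some c) x.
  by move=> x_gt0 ltx; split=> //; apply: lt_trans x_gt0; case: dom0.
have addf x y : in_dom (Some c) x -> in_dom (Some c) y -> in_dom (Some c) (x + y) ->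
    f (x + y) = f x + f y.
  move=> dx dy dxy; have := linf x 0 y dx dom0 dxy.
  rewrite add0r f0 subr0 => /(_ dy) <-; abel.
(* A condition that passes to halves and holds at one value of [f] holds on a whole interval to the
   right of [0]. *)
have germ (Q : M -> Prop) x : vdef (fun v => Q (v 1%N)) -> (forall y, Q (y + y) -> Q y) ->
    0 < x -> in_dom (Some c) x -> Q (f x) ->
    exists2 e : M, 0 < e & forall y, 0 < y -> y < e -> Q (f y).
  move=> defQ halfQ x_gt0 dx Qx.
  have [|||e e_gt0 He] := @tame_halving _ x (@tame_dom (fun x y => in_dom (Some c) x /\ y = f x) Q deff defQ).
  - by split=> //; exists (f x).
  - by move=> y [].
  - move=> y [y_gt0 [_ [dy ->] Qy]]; have [z eqz] := ex_half y.
    have z_gt0 := half_gt0 eqz y_gt0.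
    have dz := dom_pos _ z_gt0 (lt_trans (half_lt eqz y_gt0) dy.2).
    exists z => //; split=> //; exists (f z) => //; apply: halfQ.
    by rewrite -addf ?eqz.
  by exists e => // y y_gt0 lty; case: (He _ y_gt0 lty) => _ [_ [_ ->]].
have germ2 (Q Q' : M -> Prop) x x' : vdef (fun v => Q (v 1%N)) -> (forall y, Q (y + y) -> Q y) ->
    vdef (fun v => Q' (v 1%N)) -> (forall y, Q' (y + y) -> Q' y) ->
    (forall y, Q y -> Q' y -> False) ->
    0 < x -> in_dom (Some c) x -> Q (f x) -> 0 < x' -> in_dom (Some c) x' -> Q' (f x') -> False.
  move=> defQ hQ defQ' hQ' disj x0 dx Qx x0' dx' Qx'.
  have [e e_gt0 He] := germ Q x defQ hQ x0 dx Qx.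
  have [e' e'_gt0 He'] := germ Q' x' defQ' hQ' x0' dx' Qx'.
  have [e2 e2_gt0 [le1 le2]] := ex_pos_le2 e_gt0 e'_gt0.
  have [y y_gt0 lty] := ex_between e2_gt0.
  by apply: (disj (f y)); [apply: He|apply: He'] => //; apply: lt_le_trans lty _.
have hpos y : 0 < y + y -> 0 < y by exact: half_gt0.
have hneg y : y + y < 0 -> y < 0.
  move=> lt; have := @half_gt0 (- (y + y)) (- y) => h.
  have : 0 < - y by apply: h; [abel|apply: (lt_by lt); abel].
  by move=> {}lt; apply: (lt_by lt); abel.
have disjpn (y : M) : 0 < y -> y < 0 -> False by move=> h1 /(lt_trans h1); rewrite ltxx.
(* The end [c] is outside the domain, so the values are bounded by that at its half [h]; the bound
   doubles on the rest of the domain. *)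
have [h eqh] := ex_half c.
have h_gt0 := half_gt0 eqh c_gt0; have h_lt := half_lt eqh c_gt0.
have dh := dom_pos _ h_gt0 h_lt.
have [F F_ge0 [F1 F2]] := ex_ge0_within (f h).
have nF_le0 : - F <= 0 by apply: (le_by F_ge0); abel.
have small x : 0 < x -> x < h -> within F (f x).
  move=> x_gt0 ltx; have x'_gt0 : 0 < h - x by apply: (lt_by ltx); abel.
  have dx := dom_pos _ x_gt0 (lt_trans ltx h_lt).
  have dx' : in_dom (Some c) (h - x).
    by apply: dom_pos => //; apply: lt_trans h_lt; apply: (lt_by x_gt0); abel.
  have eqfh : f h = f x + f (h - x) by rewrite -addf ?subrKC.
  case: (lt_or_le 0 (f x)) => [fx|].
    have fx' : 0 <= f (h - x).
      case: (lt_or_le 0 (f (h - x))) => [/ltW //|]; rewrite le_eqVlt => /predU1P[->//|lt].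
      by case: (@germ2 (fun y => 0 < y) (fun y => y < 0) x (h - x)) => //; [exact: vdef_gt|exact: vdef_ltc].
    split; first exact: le_trans (ltW fx).
    by apply: le_trans F2; rewrite eqfh; apply: (le_by fx'); abel.
  rewrite le_eqVlt => /predU1P[->//|fx].
  have fx' : f (h - x) <= 0.
    case: (lt_or_le 0 (f (h - x))) => // lt.
    by case: (@germ2 (fun y => 0 < y) (fun y => y < 0) (h - x) x) => //; [exact: vdef_gt|exact: vdef_ltc].
  split; last exact: le_trans (ltW fx) F_ge0.
  by apply: le_trans F1 _; rewrite eqfh; apply: (le_by fx'); abel.
have pos x : 0 < x -> x < c -> within (F + F) (f x).
  move=> x_gt0 ltx; have [z eqz] := ex_half x.
  have z_gt0 := half_gt0 eqz x_gt0; have ltz := half_lt eqz x_gt0.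
  have dz := dom_pos _ z_gt0 (lt_trans ltz ltx).
  rewrite -eqz addf ?eqz //; last exact: dom_pos.
  suff lt_zh : z < h by apply: withinD; exact: small.
  case: (lt_or_le z h) => // le; case: (le_not_lt (leD le le)).
  by rewrite eqz eqh.
exists (F + F) => x dx; case: (lt_or_le 0 x) => [lt|]; first exact: pos lt dx.2.
rewrite le_eqVlt => /predU1P[->|lt].
  by rewrite f0; split; [apply: (le_by (leD F_ge0 F_ge0))|apply: (le_by (leD F_ge0 F_ge0))]; abel.
have x'_gt0 : 0 < - x by apply: (lt_by lt); abel.
have x'_lt : - x < c by apply: (lt_by dx.1); abel.
have := addf x (- x) dx (dom_pos _ x'_gt0 x'_lt).
rewrite subrr f0 => /(_ dom0) /esym /eqP; rewrite addr_eq0 => /eqP ->.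
by apply: withinN; apply: pos.
Qed.

(** * Linear forms and coarsely linear sets *)

(** Homogeneous linear combinations of coordinates with definable endomorphisms as coefficients,
    described as functions so that no normal form is maintained. *)
Inductive lform : ((nat -> M) -> M) -> Prop :=
| lform_zero : lform (fun _ => 0)
| lform_var i : lform (fun v => v i)
| lform_add h g : lform h -> lform g -> lform (fun v => h v + g v)
| lform_scale f h : endo f -> lform h -> lform (fun v => f (h v)).

Lemma lform_sub h g : lform h -> lform g -> lform (fun v => h v - g v).
Proof.
move=> lh lg; apply: lform_add => //.
exact: (lform_scale (endo_opp endo_id) lg).
Qed.

Lemma lform_subst h i e : lform h -> lform e -> lform (fun v => h (upd v i (e v))).
Proof.
move=> lh le; elim: lh => [|j|g g' _ lg _ lg'|f g ef _ lg].
- exact: lform_zero.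
- by rewrite /upd; case: (j == i) => //; exact: lform_var.
- exact: lform_add.
- exact: (lform_scale ef lg).
Qed.

Lemma lformD h v w : lform h -> h (fun j => v j + w j) = h v + h w.
Proof.
elim=> [|j|g g' _ lg _ lg'|f g ef _ lg] //; first by rewrite addr0.
  by rewrite lg lg' addrACA.
by rewrite lg ef.1.
Qed.

Lemma lformB h v w : lform h -> h (fun j => v j - w j) = h v - h w.
Proof.
move=> lh; apply/eqP; rewrite eq_sym subr_eq -lformD //; apply/eqP; congr h.
by apply: functional_extensionality => j; rewrite subrK.
Qed.

Lemma lform_line h (phi : nat -> M -> M) :
  lform h -> (forall j, endo (phi j)) -> endo (fun y => h (fun j => phi j y)).
Proof.
move=> lh ephi; elim: lh => [|j|g g' _ lg _ lg'|f g ef _ lg] //.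
- exact: endo_cst0.
- exact: endo_add.
- exact: (endo_comp ef lg).
Qed.

(** The coefficient [mu] of coordinate [i] is the restriction of the form to the [i]-th axis. *)
Lemma lform_upd h i : lform h ->
  exists2 mu, endo mu & forall v a, h (upd v i a) = mu a + h (upd v i 0).
Proof.
move=> lh; pose phi j := if j == i then (id : M -> M) else fun=> 0.
have ephi j : endo (phi j).
  by rewrite /phi; case: (j == i); [exact: endo_id|exact: endo_cst0].
exists (fun y => h (fun j => phi j y)); first exact: lform_line.
move=> v a; rewrite -lformD //; congr h; apply: functional_extensionality => j.
by rewrite /phi /upd; case: (j == i); rewrite ?addr0 ?add0r.
Qed.

Lemma lform_within h m : lform h ->
  exists2 m', 0 <= m' & forall v, (forall j, within m (v j)) -> within m' (h v).
Proof.
elim=> [|j|g g' _ [n n0 Hn] _ [n' n'0 Hn']|f g ef _ [n n0 Hn]].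
- by exists 0 => // v _; split; rewrite ?oppr0.
- have [n lemn n0] := ex_ge2 m 0; exists n => // v Hv; exact: within_le (Hv j).
- exists (n + n') => [|v Hv]; first by rewrite -[0]addr0 leD.
  by apply: withinD; [exact: Hn|exact: Hn'].
- have [k k0 Hk] := endo_within n ef; exists k => // v Hv; exact: Hk (Hn _ Hv).
Qed.

(** Equality of truncations to [[-m, m]], all values beyond the same end being identified. *)
Definition agree m a b := a = b \/ (m < a /\ m < b) \/ (a < - m /\ b < - m).

Lemma agree_sym m a b : agree m a b -> agree m b a.
Proof. by move=> [->|[[]|[]]]; [left|right; left|right; right]. Qed.

Lemma agree_le m n a b : m <= n -> agree n a b -> agree m a b.
Proof.
have leN : m <= n -> - n <= - m by move=> le; apply: (le_by le); abel.
move=> le [->|[[lta ltb]|[lta ltb]]]; [by left|right; left|right; right].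
  by split; exact: le_lt_trans le _.
by split; apply: lt_le_trans (leN le).
Qed.

Lemma agree_shift m n x a b : within m x -> agree (n + m) a b -> agree n (x + a) (x + b).
Proof.
move=> [x1 x2] [->|[[lta ltb]|[lta ltb]]]; [by left|right; left|right; right].
  by split; [apply: (lt_by (leltD x1 lta))|apply: (lt_by (leltD x1 ltb))]; abel.
by split; [apply: (lt_by (leltD x2 lta))|apply: (lt_by (leltD x2 ltb))]; abel.
Qed.

Lemma agree_within m a b : agree m a b -> within m a -> a = b.
Proof. by move=> [//|[[lt _]|[lt _]]] [h1 h2]; [case: (le_not_lt h2)|case: (le_not_lt h1)]. Qed.

(** The inverse maps [[-m, m]] into some [[-m', m']], so arguments beyond [m'] have values beyond
    [m], on the side given by the sign of [f]. *)
Lemma agree_endo f a m : endo f -> f a != 0 -> 0 <= m ->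
  exists m', forall x y, agree m' x y -> agree m (f x) (f y).
Proof.
move=> ef nefa m_ge0; have [g eg [fg gf]] := endo_inv ef nefa.
have [m' m'_ge0 Hm'] := endo_within m eg.
have nm'_le0 : - m' <= 0 by apply: (le_by m'_ge0); abel.
have nm_le0 : - m <= 0 by apply: (le_by m_ge0); abel.
have far x : ~ within m' x -> m < f x \/ f x < - m.
  move=> nw; case: (within_cases m (f x)) => [|[|/Hm']]; [by left|by right|].
  by rewrite gf.
have pos_far x : m' < x -> ~ within m' x by move=> lt [_ le]; case: (le_not_lt le).
have neg_far x : x < - m' -> ~ within m' x by move=> lt [le _]; case: (le_not_lt le).
have up x : 0 < f x -> m < f x \/ f x < - m -> m < f x.
  by move=> h [//|lt]; case: (le_not_lt (le_trans (ltW lt) nm_le0)).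
have down x : f x < 0 -> m < f x \/ f x < - m -> f x < - m.
  by move=> h [lt|//]; case: (le_not_lt (le_trans m_ge0 (ltW lt))).
exists m' => x y [->|[[ltx lty]|[ltx lty]]]; first by left.
  have x0 := le_lt_trans m'_ge0 ltx; have y0 := le_lt_trans m'_ge0 lty.
  have fx := far _ (pos_far _ ltx); have fy := far _ (pos_far _ lty).
  case: (endo_sign ef) => [f0|[sgn|sgn]]; first by rewrite f0 eqxx in nefa.
    by right; left; split; apply: up => //; exact: sgn.
  by right; right; split; apply: down => //; exact: sgn.
have nx0 : 0 < - x by apply: (lt_by (lt_le_trans ltx nm'_le0)); abel.
have ny0 : 0 < - y by apply: (lt_by (lt_le_trans lty nm'_le0)); abel.
have fx := far _ (neg_far _ ltx); have fy := far _ (neg_far _ lty).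
case: (endo_sign ef) => [f0|[sgn|sgn]]; first by rewrite f0 eqxx in nefa.
  have := sgn _ nx0; have := sgn _ ny0; rewrite !endoN // => hy hx.
  by right; right; split; apply: down => //; [apply: (lt_by hx)|apply: (lt_by hy)]; abel.
have := sgn _ nx0; have := sgn _ ny0; rewrite !endoN // => hy hx.
by right; left; split; apply: up => //; [apply: (lt_by hx)|apply: (lt_by hy)]; abel.
Qed.

(* The sets defined by the truncations to [-m, m] of finitely many linear forms:
   boolean combinations of half-spaces and of preimages of arbitrary bounded sets. *)
Definition coarse (S : (nat -> M) -> Prop) : Prop :=
  exists (T : finType) (H : T -> (nat -> M) -> M) (m : M),
    [/\ 0 <= m, forall t, lform (H t) &
        forall v w, (forall t, agree m (H t v) (H t w)) -> S v -> S w].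

Lemma coarse_ext S S' : (forall v, S v <-> S' v) -> coarse S -> coarse S'.
Proof.
move=> eqS [T [H [m [m0 lH HS]]]]; exists T, H, m; split=> // v w agr.
by rewrite -!eqS; exact: HS.
Qed.

Lemma coarse_not S : coarse S -> coarse (fun v => ~ S v).
Proof.
move=> [T [H [m [m0 lH HS]]]]; exists T, H, m; split=> // v w agr nSv Sw.
by apply: nSv; apply: HS Sw => t; exact: agree_sym.
Qed.

Lemma coarse_and S S' : coarse S -> coarse S' -> coarse (fun v => S v /\ S' v).
Proof.
move=> [T [H [m [m0 lH HS]]]] [T' [H' [m' [m0' lH' HS']]]].
have [n le le'] := ex_ge2 m m'.
exists (T + T')%type, (fun t => match t with inl t => H t | inr t => H' t end), n.
split=> [|[]//|v w agr [Sv S'v]]; first exact: le_trans le.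
split; [apply: HS Sv => t|apply: HS' S'v => t].
  exact: agree_le le (agr (inl t)).
exact: agree_le le' (agr (inr t)).
Qed.

(** * Elimination of a quantifier by back-and-forth *)

Lemma seq_max (s : seq M) : s <> [::] -> exists2 x, x \in s & forall y, y \in s -> y <= x.
Proof.
elim: s => // x [|x' s] IHs _.
  by exists x; rewrite ?mem_head // => y; rewrite inE => /eqP->.
have [//|z zs lez] := IHs; case: (lt_or_le x z) => [/ltW|] le.
  exists z; first by rewrite inE zs orbT.
  by move=> y; rewrite inE => /predU1P[->//|/lez].
exists x; first exact: mem_head.
by move=> y; rewrite inE => /predU1P[->//|/lez /le_trans]; apply.
Qed.

Lemma seq_min (s : seq M) : s <> [::] -> exists2 x, x \in s & forall y, y \in s -> x <= y.
Proof.
elim: s => // x [|x' s] IHs _.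
  by exists x; rewrite ?mem_head // => y; rewrite inE => /eqP->.
have [//|z zs lez] := IHs; case: (lt_or_le x z) => [/ltW|] le.
  exists x; first exact: mem_head.
  by move=> y; rewrite inE => /predU1P[->//|/lez]; apply: le_trans.
exists z; first by rewrite inE zs orbT.
by move=> y; rewrite inE => /predU1P[->//|/lez].
Qed.

(** Density provides a point between the maximum of [s] and the minimum of [s']; if only one list is
    empty, [e] is the step past the other. *)
Lemma ex_cut (e : M) (s s' : seq M) : 0 < e ->
  (forall x y, x \in s -> y \in s' -> x < y) ->
  exists2 b, (forall x, x \in s -> x < b) & (forall y, y \in s' -> b < y).
Proof.
move=> e_gt0 lt_ss'; case: (eqVneq s [::]) => [->|/eqP/seq_max[p ps lep]].
  case: (eqVneq s' [::]) => [->|/eqP/seq_min[q qs leq]]; first by exists 0.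
  exists (q - e) => // y /leq; apply: lt_le_trans; by apply: (lt_by e_gt0); abel.
case: (eqVneq s' [::]) => [->|/eqP/seq_min[q qs leq]].
  exists (p + e) => // x /lep le; apply: (le_lt_trans le); by apply: (lt_by e_gt0); abel.
have [b ltp ltq] := ex_between (lt_ss' _ _ ps qs).
by exists b => [x /lep le|y /leq]; [exact: le_lt_trans ltp|exact: lt_le_trans].
Qed.

(** If [a] is near some root, its offset from that root is copied. Otherwise [b] has to fill the
    corresponding cut among the [r' t]. Precision [m + m] is what either case consumes. *)
Lemma back_and_forth (T : finType) (r r' : T -> M) (m : M) a : 0 <= m ->
  (forall t u, agree (m + m) (r t - r u) (r' t - r' u)) ->
  exists b, forall t, agree m (a - r t) (b - r' t).
Proof.
move=> m_ge0 agr.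
case: (classic (exists t, within m (a - r t))) => [[t nt]|far].
  exists (r' t + (a - r t)) => u.
  rewrite (_ : a - r u = (a - r t) + (r t - r u)); last by abel.
  rewrite (_ : _ - r' u = (a - r t) + (r' t - r' u)); last by abel.
  exact: agree_shift nt (agr t u).
case: (pickP T) => [t0 _|noT]; last by exists 0 => t; have := noT t.
have {}far t : m < a - r t \/ a - r t < - m.
  case: (within_cases m (a - r t)) => [|[|w]]; [by left|by right|by case: far; exists t].
have nm_le0 : - m <= 0 by apply: (le_by m_ge0); abel.
(* A far root witnesses that [M] is nontrivial. *)
have [e e_gt0] : exists e : M, 0 < e.
  case: (far t0) => lt; first by exists (a - r t0); exact: le_lt_trans lt.
  by exists (- (a - r t0)); apply: (lt_by (lt_le_trans lt nm_le0)); abel.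
(* The elements of [s] must lie below [b] and those of [s'] above it. *)
pose s := [seq r' t + m | t <- enum T & m < a - r t].
pose s' := [seq r' t - m | t <- enum T & a - r t < - m].
have [|b ltb gtb] := @ex_cut e s s' e_gt0.
  move=> _ _ /mapP[t + ->] /mapP[u + ->]; rewrite !mem_filter => /andP[ht _] /andP[hu _].
  (* Roots on opposite sides of [a] are more than [m + m] apart, and agreement carries this gap over
     to [r']. *)
  have gap : m + m < r u - r t by apply: (lt_by (ltD ht hu)); abel.
  have gap' : m + m < r' u - r' t.
    case: (agr u t) => [<-//|[[_ //]|[lt _]]].
    have nmm : - (m + m) <= 0 by apply: (le_by (leD m_ge0 m_ge0)); abel.
    have mm : 0 <= m + m by apply: (le_by (leD m_ge0 m_ge0)); abel.
    by case: (le_not_lt (le_trans (ltW lt) (le_trans nmm mm))).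
  by apply: (lt_by gap'); abel.
exists b => t; case: (far t) => lt; right; [left|right]; split=> //.
  have /ltb h : r' t + m \in s by apply: map_f; rewrite mem_filter lt mem_enum.
  by apply: (lt_by h); abel.
have /gtb h : r' t - m \in s' by apply: map_f; rewrite mem_filter lt mem_enum.
by apply: (lt_by h); abel.
Qed.

(** If the coefficient [mu] of coordinate [i] vanishes, the value does not depend on [a], and
    agreement at [0] suffices. Otherwise the form is [mu (a - rho v)], with [rho] its root in that
    coordinate, and [agree_endo] applies. *)
Lemma lform_root h i m : lform h -> 0 <= m ->
  exists2 rho, lform rho & exists m1, forall v w a b,
    agree m (h (upd v i 0)) (h (upd w i 0)) -> agree m1 (a - rho v) (b - rho w) ->
    agree m (h (upd v i a)) (h (upd w i b)).
Proof.
move=> lh m_ge0; have [mu emu defmu] := lform_upd i lh.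
case: (classic (exists a, mu a != 0)) => [[a0 ne]|mu0]; last first.
  exists (fun=> 0); first exact: lform_zero.
  have {}mu0 a : mu a = 0 by apply/eqP/negPn/negP => ne; apply: mu0; exists a.
  by exists 0 => v w a b; rewrite (defmu v a) (defmu w b) !mu0 !add0r.
have [g eg [fg gf]] := endo_inv emu ne; have [m1 Hm1] := agree_endo emu ne m_ge0.
exists (fun v => - g (h (upd v i 0))).
  exact: (lform_scale (endo_opp eg) (lform_subst i lh lform_zero)).
exists m1 => v w a b _ /Hm1.
by rewrite !opprK !emu.1 !fg -!defmu.
Qed.

(** The new forms are the old ones with coordinate [i] set to [0] and the differences of roots; they
    let [back_and_forth] match a witness [a] at [v] by a witness [b] at [w]. *)
Lemma coarse_ex i S : coarse S -> coarse (fun v => exists a, S (upd v i a)).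
Proof.
move=> [T [H [m [m_ge0 lH HS]]]].
have root t := lform_root i (lH t) m_ge0.
have {}root t : {rho | lform rho /\ exists m1, forall v w a b,
    agree m (H t (upd v i 0)) (H t (upd w i 0)) -> agree m1 (a - rho v) (b - rho w) ->
    agree m (H t (upd v i a)) (H t (upd w i b))}.
  by apply: constructive_indefinite_description; have [rho] := root t; exists rho.
pose rho t := sval (root t).
have lrho t : lform (rho t) by rewrite /rho; case: (root t) => ? [].
have [|t|m1 m1_ge0 Hm1] := @ex_uniform T (fun t m1 => forall v w a b,
    agree m (H t (upd v i 0)) (H t (upd w i 0)) -> agree m1 (a - rho t v) (b - rho t w) ->
    agree m (H t (upd v i a)) (H t (upd w i b))).
- move=> t n n' le Hn v w a b agr0 agr; exact: Hn agr0 (agree_le le agr).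
- by rewrite /rho; case: (root t) => ? [].
(* The threshold must preserve the old forms at precision [m] and the root differences at
   [m1 + m1]. *)
have [m2 le1 le2] := ex_ge2 m (m1 + m1).
exists (T + T * T)%type, (fun k => match k with
  | inl t => fun v => H t (upd v i 0)
  | inr tu => fun v => rho tu.1 v - rho tu.2 v end), m2; split.
- exact: le_trans le1.
- case=> [t|tu]; last by apply: lform_sub.
  exact: (lform_subst i (lH t) lform_zero).
move=> v w agr [a Sa].
have [|b Hb] := @back_and_forth T (rho^~ v) (rho^~ w) m1 a m1_ge0.
  by move=> t u; apply: agree_le le2 (agr (inr (t, u))).
exists b; apply: HS Sa => t; apply: Hm1 (Hb t).
exact: agree_le le1 (agr (inl t)).
Qed.

(** * Coarseness of the sets definable in the semibounded reduct *)

Lemma coarse_half_space h : lform h -> coarse (fun v => 0 < h v).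
Proof.
move=> lh; exists unit, (fun=> h), 0; split=> // v w /(_ tt)[->//|[[_ //]|[]]].
by rewrite oppr0 => h1 _ h2; have := lt_trans h1 h2; rewrite ltxx.
Qed.

Lemma coarse_hyperplane h : lform h -> coarse (fun v => h v = 0).
Proof.
move=> lh; exists unit, (fun=> h), 0; split=> // v w /(_ tt)[->//|[[+ _]|[+ _]]] eq0.
  by rewrite eq0 ltxx.
by rewrite eq0 oppr0 ltxx.
Qed.

(** Truncation beyond the bound of [R] loses nothing on [R]: a point agreeing with one of [R] has
    the same coordinates. *)
Lemma coarse_bounded n (R : ('I_n -> M) -> Prop) (m : M) (args : 'I_n -> nat) :
  (forall x : 'I_n -> M, R x -> forall k, within m (x k)) -> coarse (fun v => R (fun k => v (args k))).
Proof.
move=> bR; have [n0 le n0_ge0] := ex_ge2 m 0.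
exists 'I_n, (fun k v => v (args k)), n0; split=> // [t|v w agr Rv]; first exact: lform_var.
suff <- : (fun k => v (args k)) = (fun k => w (args k)) by [].
apply: functional_extensionality => k; apply: agree_within (agr k) _.
exact: within_le le (bR _ Rv k).
Qed.

Lemma absg_le a m : absg a <= m <-> within m a.
Proof.
rewrite /absg; case: ifP => [lt|/negP ge]; split.
- move=> le; have le' : - m <= a by apply: (le_by le); abel.
  split=> //; apply: le_trans (ltW lt) _; apply: le_trans le.
  by apply: (le_by (ltW lt)); abel.
- by case=> le _; apply: (le_by le); abel.
- case: (lt_or_le a 0) => // a_ge0 le; split=> //.
  by apply: (le_by (leD a_ge0 (le_trans a_ge0 le))); abel.
- by case.
Qed.

Lemma max_le a b m : Order.max a b <= m <-> a <= m /\ b <= m.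
Proof.
rewrite /Order.max; case: ifP => [lt|/negP nlt]; split=> [le|[]//]; split=> //.
  exact: le_trans (ltW lt) le.
by case: (lt_or_le a b) => // ge; apply: le_trans ge le.
Qed.

Lemma normv_le n (x : 'I_n -> M) m : normv x <= m <-> 0 <= m /\ forall k, within m (x k).
Proof.
rewrite /normv; suff -> : foldr Order.max 0 [seq absg (x j) | j <- enum 'I_n] <= m <->
    0 <= m /\ forall k, k \in enum 'I_n -> within m (x k).
  by split=> -[m0 Hx]; split=> // k; apply: Hx; rewrite mem_enum.
elim: (enum 'I_n) => [|k s IHs] /=; first by split=> [|[]].
rewrite max_le IHs absg_le; split=> [[wk [m0 Hs]]|[m0 Hs]].
  by split=> // j; rewrite inE => /predU1P[->|/Hs].
split; first by apply: Hs; rewrite mem_head.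
by split=> // j js; apply: Hs; rewrite inE js orbT.
Qed.

(** Order, addition and zero give half-spaces and hyperplanes. A partial endomorphism has a bounded
    graph if its domain is bounded; if it is total, its graph is a hyperplane. *)
Lemma coarse_atom n (R : ('I_n -> M) -> Prop) args :
  semibounded_reduct P R -> coarse (fun v => R (fun k => v (args k))).
Proof.
have get0 (v : nat -> M) k (a : 'I_k.+1 -> nat) : getn (fun k => v (a k)) 0 = v (a ord0).
  by rewrite /getn; case: insubP => // i _ /= i0; congr (v (a _)); apply: val_inj.
have get1 (v : nat -> M) k (a : 'I_k.+2 -> nat) : getn (fun k => v (a k)) 1 = v (a (inord 1)).
  rewrite /getn; case: insubP => // i _ /= i1; congr (v (a _)); apply: val_inj.
  by rewrite /= inordK.
have get2 (v : nat -> M) k (a : 'I_k.+3 -> nat) : getn (fun k => v (a k)) 2 = v (a (inord 2)).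
  rewrite /getn; case: insubP => // i _ /= i2; congr (v (a _)); apply: val_inj.
  by rewrite /= inordK.
have var := lform_var.
case=> [[eqn defR]|[[eqn defR]|[[eqn defR]|[[eqn [dfR [c [f [pf defR]]]]]|[[m bR] _]]]]].
- subst n; apply: coarse_ext (coarse_half_space (lform_sub (var (args (inord 1))) (var (args ord0)))) => v.
  by rewrite defR get0 get1; split=> lt; apply: (lt_by lt); abel.
- subst n; apply: coarse_ext (coarse_hyperplane (lform_sub
    (lform_add (var (args ord0)) (var (args (inord 1)))) (var (args (inord 2))))) => v.
  by rewrite defR get0 get1 get2; split=> [/eqP|->]; rewrite ?subrr // subr_eq0 => /eqP.
- subst n; apply: coarse_ext (coarse_hyperplane (var (args ord0))) => v.
  by rewrite defR get0.
- subst n.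
  have vR : vdef (fun v => in_dom c (v 0%N) /\ v 1%N = f (v 0%N)).
    apply: vdef_ext (vdef_definable (_ : definable P R)) => [v|].
      rewrite defR -[fun k : 'I_2 => v k]/(fun k : 'I_2 => v (val k)) get0 get1.
      by rewrite /= inordK.
    by have [g [wfg [_ defg]]] := dfR; exists g; split=> //; exists (fun=> 0).
  case: c pf defR vR => [c|] pf defR vR.
    have [m Hm] := partial_endo_bounded pf vR.
    have [m' le1 le2] := ex_ge2 m c.
    apply: (@coarse_bounded _ _ m') => x; rewrite defR => -[dx eqx] k.
    case: (ltnP 0 k) => k0.
      apply: within_le le1 _; have -> : x k = getn x 1.
        rewrite /getn; case: insubP => // j _ /= j1; congr x; apply: val_inj.
        by rewrite /= j1; case: k k0 => -[|[|]].
      by rewrite eqx; exact: Hm.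
    apply: within_le le2 _; have -> : x k = getn x 0.
      rewrite /getn; case: insubP => // j _ /= j0; congr x; apply: val_inj.
      by rewrite /= j0; case: k k0 => -[|[|]].
    by case: dx => h1 h2; split; exact: ltW.
  have ef : endo f.
    split; last by apply: vdef_ext vR => v; split=> [[]|].
    move=> x y; case: pf => _ [f0 /(_ x 0 y I I I I)]; rewrite add0r f0 subr0 => <-; abel.
  apply: coarse_ext (coarse_hyperplane (lform_sub (var (args (inord 1)))
    (lform_scale ef (var (args ord0))))) => v.
  by rewrite defR get0 get1; split=> [/eqP|[_ ->]]; rewrite ?subrr // subr_eq0 => /eqP.
apply: (@coarse_bounded _ _ m) => x /bR; by rewrite normv_le => -[].
Qed.

Lemma coarse_sat f : wf (semibounded_reduct P) f -> coarse (fun v => sat v f).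
Proof.
elim: f => /= [n R args|i j _|f IHf /IHf|f IHf g IHg [/IHf cf /IHg cg]|i f IHf /IHf].
- exact: coarse_atom.
- apply: coarse_ext (coarse_hyperplane (lform_sub (lform_var i) (lform_var j))) => v.
  by split=> [/eqP|->]; rewrite ?subrr // subr_eq0 => /eqP.
- exact: coarse_not.
- exact: coarse_and.
- exact: coarse_ex.
Qed.

(** * Kernels of linear forms on a block of coordinates *)

Definition supported (s : seq nat) (v : nat -> M) := forall j, j \notin s -> v j = 0.

(** A nonzero common kernel vector over the division ring of endomorphisms, with coordinates [phi j]
    and scalar parameter [y]. *)
Definition kernel_line (T : finType) (H : T -> (nat -> M) -> M) (D : {set T}) (s : seq nat)
    (phi : nat -> M -> M) : Prop :=
  [/\ forall j, endo (phi j), forall y, supported s (phi^~ y),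
      exists j y, phi j y != 0 & forall t y, t \in D -> H t (phi^~ y) = 0].

Lemma lform_0 h : lform h -> h (fun=> 0) = 0.
Proof.
by move=> lh; apply: (addrI (h (fun=> 0))); rewrite -lformD // !addr0.
Qed.

Lemma lform_sum h r (v : 'I_r -> nat -> M) : lform h ->
  h (fun j => \sum_(i < r) v i j) = \sum_(i < r) h (v i).
Proof.
move=> lh; elim: r v => [|r IHr] v.
  rewrite big_ord0 -[RHS](lform_0 lh); congr h.
  by apply: functional_extensionality => j; rewrite big_ord0.
rewrite big_ord_recl -IHr -lformD //; congr h.
by apply: functional_extensionality => j; rewrite big_ord_recl.
Qed.

Lemma upd_upd v i a b : upd (upd v i a) i b = upd v i b.
Proof. by apply: functional_extensionality => j; rewrite /upd; case: (j == i). Qed.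

Lemma upd_id (v : nat -> M) i : upd v i (v i) = v.
Proof. by apply: functional_extensionality => j; rewrite /upd; case: eqP => [->|]. Qed.

(* Gaussian elimination: a form involving the first coordinate is solved for it. *)
Lemma kernel_or_bounded_all (T : finType) (H : T -> (nat -> M) -> M) (s : seq nat) :
  (forall t, lform (H t)) -> uniq s ->
  (exists phi, kernel_line H setT s phi) \/
  (forall m, exists m', forall v, supported s v -> (forall t, within m (H t v)) ->
     forall j, within m' (v j)).
Proof.
elim: s H => [|i s IHs] H lH; first by
  right=> m; exists 0 => v sv _ j; rewrite sv //; split; rewrite ?oppr0.
move=> /andP[nis us].
have mus t : {mu | endo mu /\ forall v a, H t (upd v i a) = mu a + H t (upd v i 0)}.
  by apply: constructive_indefinite_description; have [mu] := lform_upd i (lH t); exists mu.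
pose mu t := sval (mus t).
have emu t : endo (mu t) by rewrite /mu; case: (mus t) => ? [].
have defmu t v a : H t (upd v i a) = mu t a + H t (upd v i 0) by rewrite /mu; case: (mus t) => ? [].
case: (classic (exists t a, mu t a != 0)) => [[t0 [a0 ne]]|mu0]; last first.
  have {}mu0 t a : mu t a = 0 by apply/eqP/negPn/negP => ne; apply: mu0; exists t, a.
  (* No form involves coordinate [i], so the [i]-th axis is a kernel line, unless [M] is trivial and
     all is bounded. *)
  case: (classic (exists e : M, e != 0)) => [[e nee]|M0]; last first.
    right=> m; exists 0 => v _ _ j; have -> : v j = 0.
      by apply/eqP/negPn/negP => ne; apply: M0; exists (v j).
    by split; rewrite ?oppr0.
  left; exists (fun j => if j == i then id else fun=> 0); split.
  - by move=> j; case: (j == i); [exact: endo_id|exact: endo_cst0].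
  - by move=> y j; rewrite inE negb_or => /andP[/negbTE ->].
  - by exists i, e; rewrite eqxx.
  move=> t y _; have := defmu t (fun=> 0) y; rewrite mu0 add0r.
  have -> : upd (fun=> 0) i 0 = (fun=> 0) :> (nat -> M).
    by apply: functional_extensionality => j; rewrite /upd; case: (j == i).
  rewrite (lform_0 (lH t)) => eq0; rewrite -[RHS]eq0; congr (H t).
  by apply: functional_extensionality => j; rewrite /upd; case: (j == i).
have [g eg [fg gf]] := endo_inv (emu t0) ne.
(* The value of coordinate [i] at which the form [t0] vanishes. *)
pose e v := - g (H t0 (upd v i 0)).
have le : lform e by exact: (lform_scale (endo_opp eg) (lform_subst i (lH t0) lform_zero)).
have [|//|[phi [ephi sphi [j0 [y0 nephi]] kphi]]|bnd] := IHs (fun t v => H t (upd v i (e v))).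
- by move=> t; exact: lform_subst.
- left; exists (fun j => if j == i then fun y => e (phi^~ y) else phi j); split.
  + by move=> j; case: (j == i) => //; exact: lform_line.
  + move=> y j; rewrite inE negb_or => /andP[/negbTE -> njs]; exact: sphi.
  + exists j0, y0; have [eqj|//] := eqVneq j0 i; move: nephi.
    by rewrite sphi ?eqxx // eqj.
  move=> t y _; rewrite -[RHS](kphi t y (in_setT t)); congr (H t).
  by apply: functional_extensionality => j; rewrite /upd; case: (j == i).
right=> m.
have [m1 m1_ge0 Hm1] := endo_within m eg.
have [||m2 m2_ge0 Hm2] := @ex_uniform T (fun t n => forall x, within m1 x -> within n (mu t x)).
- by move=> t n n' len Hn x /Hn; exact: within_le.
- by move=> t; have [n _ Hn] := endo_within m1 (emu t); exists n.
have [m3 Hm3] := bnd (m + m2).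
have [m4 m4_ge0 Hm4] := lform_within m3 le.
have [m' le3 le4] := ex_ge2 m3 (m1 + m4).
exists m' => v sv Hv.
pose v0 := upd v i 0.
(* This gives [v i - e v0 = g (H t0 v)], which is bounded; replacing [v i] by [e v0] then changes
   each form by at most [m2]. *)
have Hev t : H t v = mu t (v i) + H t v0 by rewrite -{1}(upd_id v i) defmu.
have wa : within m1 (v i - e v0).
  rewrite /e /v0 upd_upd -/v0 opprK -[v i](gf) -eg.1 -Hev; exact: Hm1.
have bv0 j : within m3 (v0 j).
  apply: Hm3 => [l|t].
    rewrite /v0 /upd; case: eqP => // /eqP nl nls; apply: sv.
    by rewrite inE negb_or nl.
  rewrite defmu /v0 upd_upd -/v0.
  have -> : mu t (e v0) + H t v0 = H t v + mu t (- (v i - e v0)).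
    rewrite Hev endoN // endoB //; abel.
  by apply: withinD => //; apply: Hm2; exact: withinN.
move=> j; have [->|nj] := eqVneq j i.
  apply: within_le le4 _; rewrite (_ : v i = (v i - e v0) + e v0); last by rewrite subrK.
  by apply: withinD => //; exact: Hm4.
by apply: within_le le3 _; have := bv0 j; rewrite /v0 upd_other.
Qed.

(** The forms outside [D] are replaced by the zero form. *)
Lemma kernel_or_bounded (T : finType) (H : T -> (nat -> M) -> M) (D : {set T}) (s : seq nat) m :
  (forall t, lform (H t)) -> uniq s -> 0 <= m ->
  (exists phi, kernel_line H D s phi) \/
  (exists m', forall v, supported s v -> (forall t, t \in D -> within m (H t v)) ->
     forall j, within m' (v j)).
Proof.
move=> lH us m_ge0; pose HD t := if t \in D then H t else fun=> 0.
have lHD t : lform (HD t) by rewrite /HD; case: ifP => // _; exact: lform_zero.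
case: (kernel_or_bounded_all lHD us) => [[phi [ephi sphi nephi kphi]]|/(_ m)[m' Hm']].
  left; exists phi; split=> // t y tD.
  by have := kphi t y (in_setT t); rewrite /HD tD.
right; exists m' => v sv Hv; apply: Hm' => // t; rewrite /HD; case: ifP => [/Hv //|_].
by split=> //; apply: (le_by m_ge0); abel.
Qed.

(** * Blocks of coordinates *)

(** By induction: half of [e] is allotted to the first summand and half to the others. *)
Lemma ex_div n (e : M) : 0 < e -> exists2 e' : M, 0 < e' &
  forall x : 'I_n -> M, (forall i, - e' < x i /\ x i < e') ->
    - e < \sum_i x i /\ \sum_i x i < e.
Proof.
elim: n e => [|n IHn] e e_gt0.
  exists e => // x _; rewrite big_ord0; split=> //.
  by apply: (lt_by e_gt0); abel.
have [h eqh] := ex_half e; have h_gt0 := half_gt0 eqh e_gt0.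
have [e1 e1_gt0 He1] := IHn h h_gt0.
have [e2 e2_gt0 [le1 le2]] := ex_pos_le2 e1_gt0 h_gt0.
have leN (a b : M) : a <= b -> - b <= - a by move=> le; apply: (le_by le); abel.
exists e2 => // x Hx; rewrite big_ord_recl.
have [s1 s2] : - h < \sum_(i < n) x (lift ord0 i) /\ \sum_(i < n) x (lift ord0 i) < h.
  apply: He1 => i; have [h1 h2] := Hx (lift ord0 i).
  by split; [apply: le_lt_trans h1; exact: leN|exact: lt_le_trans le1].
have [x1 x2] := Hx ord0.
have x1' : - h < x ord0 by apply: le_lt_trans x1; exact: leN.
have x2' : x ord0 < h by exact: lt_le_trans le2.
rewrite -eqh; split; last exact: ltD.
by rewrite opprD; exact: ltD.
Qed.

Lemma ex_uniform_small (T : finType) (Q : T -> M -> Prop) (e : M) : 0 < e ->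
  (forall t (del del' : M), del' <= del -> Q t del -> Q t del') ->
  (forall t : T, exists2 del : M, 0 < del & Q t del) ->
  exists2 del : M, 0 < del & forall t, Q t del.
Proof.
move=> e_gt0 monQ exQ.
suff [del del_gt0 Qd] : exists2 del : M, 0 < del & forall t : T, t \in enum T -> Q t del.
  by exists del => // t; apply: Qd; rewrite mem_enum.
elim: (enum T) => [|t s [del del_gt0 Qd]]; first by exists e.
have [del1 del1_gt0 Qd1] := exQ t.
have [del2 del2_gt0 [le1 le2]] := ex_pos_le2 del_gt0 del1_gt0.
exists del2 => // u; rewrite inE => /predU1P[->|/Qd]; [exact: monQ Qd1|exact: monQ].
Qed.

Lemma infinite_interval (del : M) : 0 < del ->
  exists2 Y : nat -> M, injective Y & forall q, 0 < Y q /\ Y q < del.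
Proof.
move=> del_gt0.
pose half x := proj1_sig (constructive_indefinite_description _ (ex_half x)).
have halfE x : half x + half x = x by rewrite /half; case: constructive_indefinite_description.
pose Y q := iter q.+1 half del.
have Y_gt0 q : 0 < Y q.
  by elim: q => [|q IHq]; rewrite /Y iterS; apply: half_gt0 (halfE _) _.
have Y_dec q p : (q < p)%N -> Y p < Y q.
  elim: p => // p IHp; rewrite ltnS leq_eqVlt => /predU1P[->|/IHp]; first exact: half_lt (halfE (Y p)) (Y_gt0 p).
  by apply: lt_trans; apply: half_lt (halfE (Y p)) (Y_gt0 p).
exists Y => [q p eqY|q]; last first.
  split=> //; case: q => [|q]; first exact: half_lt (halfE del) del_gt0.
  by apply: lt_trans (Y_dec 0%N q.+1 isT) _; exact: half_lt (halfE del) del_gt0.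
by case: (ltngtP q p) => // /Y_dec; rewrite eqY ltxx.
Qed.

Section Blocks.
Variables (r : nat) (d : 'I_r -> nat).
Local Arguments blk {M r d} z i _.

(** The offsets [off], extended so that block [i] ends at [prefix i.+1] and the total dimension is
    [prefix r]. *)
Let prefix n : nat := (\sum_(j < r | (j < n)%N) d j)%N.

Let prefixS (i : 'I_r) : prefix i.+1 = (prefix i + d i)%N.
Proof.
rewrite /prefix (bigD1 i) //= addnC; congr (_ + _)%N; apply: eq_bigl => j.
by rewrite ltnS -val_eqE /= ltn_neqAle andbC.
Qed.

Let prefix_mono n n' : (n <= n')%N -> (prefix n <= prefix n')%N.
Proof.
move=> len; rewrite /prefix [X in (X <= _)%N]big_mkcond [X in (_ <= X)%N]big_mkcond /=.
apply: leq_sum => j _; case: ifP => // ltj.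
by rewrite (leq_trans ltj).
Qed.

Lemma block_exists j : (j < Dsum d)%N -> exists i : 'I_r, (off d i <= j < off d i + d i)%N.
Proof.
have -> : Dsum d = prefix r by apply: eq_bigl => i; rewrite ltn_ord.
elim: {1 3}r (leqnn r) => [|n IHn] len; first by rewrite /prefix big_pred0.
case: (ltnP j (prefix n)) => [ltj _|gej]; first exact: IHn (ltnW len) ltj.
rewrite (prefixS (Ordinal len)) => ltj; exists (Ordinal len).
by rewrite -/(prefix _) gej.
Qed.

Lemma block_unique i i' j :
  (off d i <= j < off d i + d i)%N -> (off d i' <= j < off d i' + d i')%N -> i = i'.
Proof.
rewrite -![off d _]/(prefix _) -!prefixS => /andP[h1 h2] /andP[h3 h4].
apply: val_inj; case: (ltngtP i i') => // lt.
  by have := leq_ltn_trans (leq_trans (prefix_mono lt) h3) h2; rewrite ltnn.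
by have := leq_ltn_trans (leq_trans (prefix_mono lt) h1) h4; rewrite ltnn.
Qed.

Lemma getn_lt n (x : 'I_n -> M) (l : 'I_n) : getn x l = x l.
Proof. by rewrite /getn valK. Qed.

Lemma getn_ge n (x : 'I_n -> M) l : (n <= l)%N -> getn x l = 0.
Proof. by move=> ge; rewrite /getn insubN // -leqNgt. Qed.

Lemma blk_inj (z z' : 'I_(Dsum d) -> M) : (forall i, blk z i = blk z' i) -> z = z'.
Proof.
move=> eqb; apply: functional_extensionality => j.
have [i /andP[h1 h2]] := block_exists (ltn_ord j).
have lt : (j - off d i < d i)%N by rewrite ltn_subLR.
have := congr1 (fun u => u (Ordinal lt)) (eqb i).
by rewrite /blk /= subnKC // !getn_lt.
Qed.

Variables (k : nat) (p : nat -> M).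

(** The valuation at which the formula of the family is evaluated; [p] supplies its parameters. *)
Definition pair_val (b : 'I_k -> M) (z : 'I_(Dsum d) -> M) : nat -> M :=
  ext (fun j => match split j with inl i => b i | inr i => z i end) p.

Definition block_vec (i : 'I_r) (u : 'I_(d i) -> M) : nat -> M :=
  fun j => if (k + off d i <= j)%N then getn u (j - (k + off d i)) else 0.

Definition block_seq (i : 'I_r) := iota (k + off d i) (d i).

Lemma block_vec_supported i u : supported (block_seq i) (@block_vec i u).
Proof.
move=> j; rewrite mem_iota /block_vec => nj; case: ifP => // le.
by rewrite getn_ge // leq_subRL //; move: nj; rewrite le /= -leqNgt.
Qed.

Lemma pair_val_sub (b : 'I_k -> M) (z z' : 'I_(Dsum d) -> M) j : pair_val b z j - pair_val b z' j =
  if (k <= j)%N then getn z (j - k) - getn z' (j - k) else 0.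
Proof.
rewrite /pair_val /ext; case: insubP => [o lt eqo|]; last first.
  rewrite -leqNgt => ge; rewrite subrr; case: ifP => // le.
  by rewrite !getn_ge ?subrr // leq_subRL.
rewrite -eqo /=; case: splitP => [i ->|i ->]; first by rewrite leqNgt ltn_ord subrr.
by rewrite leq_addr addKn !getn_lt.
Qed.

(** The coordinates of [b] and the parameters cancel, leaving the displacements of the blocks. *)
Lemma pair_val_blocks (b : 'I_k -> M) (z z' : 'I_(Dsum d) -> M) : (fun j => pair_val b z j - pair_val b z' j) =
  (fun j => \sum_(i < r) block_vec (subv (blk z i) (blk z' i)) j).
Proof.
apply: functional_extensionality => j; rewrite pair_val_sub.
have out i (u : 'I_(d i) -> M) :
    ~~ (k + off d i <= j < k + off d i + d i)%N -> block_vec u j = 0.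
  by move=> nj; apply: block_vec_supported; rewrite mem_iota.
case: leqP => [lekj|ltjk]; last first.
  rewrite big1 // => i _; apply: out; apply/negP => /andP[h _].
  by have := leq_trans (leq_addr _ _) h; rewrite leqNgt ltjk.
case: (ltnP (j - k) (Dsum d)) => [ltD|geD]; last first.
  rewrite !getn_ge // subrr big1 // => i _; apply: out; apply/negP => /andP[_ h].
  have : (j - k < prefix i.+1)%N by rewrite prefixS ltn_subLR // addnA.
  have {}geD : (prefix r <= j - k)%N.
    by rewrite (_ : prefix r = Dsum d) //; apply: eq_bigl => i'; rewrite ltn_ord.
  by rewrite ltnNge (leq_trans (prefix_mono (ltn_ord i)) geD).
have [i /andP[h1 h2]] := block_exists ltD.
rewrite (bigD1 i) //= [X in _ = _ + X]big1 ?addr0 => [|i' nei]; last first.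
  apply: out; apply/negP => /andP[h3 h4]; case/eqP: nei; symmetry.
  apply: (@block_unique i i' (j - k)); first by rewrite h1 h2.
  by rewrite leq_subRL // h3 ltn_subLR // addnA.
have le : (k + off d i <= j)%N by rewrite -leq_subRL.
have lt : (j - (k + off d i) < d i)%N by rewrite ltn_subLR // -addnA -ltn_subLR.
rewrite /block_vec le -[(j - (k + off d i))%N]/(val (Ordinal lt)) getn_lt /subv /blk /=.
by rewrite subnDA subnKC.
Qed.
Variables (T : finType) (H : T -> (nat -> M) -> M) (m : M).
Hypotheses (m_ge0 : 0 <= m) (lH : forall t, lform (H t)).

(** The piece containing [v]; [None] marks a form with value in [[-m, m]]. *)
Definition pattern (v : nat -> M) : {ffun T -> option bool} :=
  [ffun t => if m < H t v then Some true else if H t v < - m then Some false else None].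

Definition near (sigma : {ffun T -> option bool}) : {set T} := [set t | sigma t == None].

Lemma mem_near v t : t \in near (pattern v) <-> within m (H t v).
Proof.
rewrite inE ffunE; case: ifP => [lt|/negP nlt]; first by split=> // -[_ /le_not_lt].
case: ifP => [lt|/negP nlt']; first by split=> // -[/le_not_lt].
by split=> // _; case: (within_cases m (H t v)) => [|[]].
Qed.

Lemma not_near v t : t \notin near (pattern v) -> m < H t v \/ H t v < - m.
Proof.
move=> nt; case: (within_cases m (H t v)) => [|[|/mem_near]]; [by left|by right|].
by rewrite (negbTE nt).
Qed.

Lemma agree_perturb a : m < a \/ a < - m ->
  exists2 e : M, 0 < e & forall x, - e < x -> x < e -> agree m a (a + x).
Proof.
case=> lt.
  exists (a - m) => [|x x1 x2]; first by apply: (lt_by lt); abel.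
  by right; left; split=> //; apply: (lt_by x1); abel.
exists (- m - a) => [|x x1 x2]; first by apply: (lt_by lt); abel.
by right; right; split=> //; apply: (lt_by x2); abel.
Qed.


Lemma block_vecK i v : supported (block_seq i) v ->
  block_vec (fun l : 'I_(d i) => v (k + off d i + l)%N) = v.
Proof.
move=> sv; apply: functional_extensionality => j.
have [|nj] := boolP (j \in block_seq i); last by rewrite sv // block_vec_supported.
rewrite mem_iota => /andP[le lt]; rewrite /block_vec le.
have lt' : (j - (k + off d i) < d i)%N by rewrite ltn_subLR.
by rewrite -[(j - _)%N]/(val (Ordinal lt')) getn_lt /= subnKC.
Qed.

Variables (I : ('I_k -> M) -> Prop) (E : ('I_k -> M) -> ('I_(Dsum d) -> M) -> Prop).
Hypothesis HE : forall (b : 'I_k -> M) (z z' : 'I_(Dsum d) -> M), I b ->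
  (forall t, agree m (H t (pair_val b z)) (H t (pair_val b z'))) -> E b z -> E b z'.
Hypothesis r_gt0 : (0 < r)%N.

Lemma form_blocks t (b : 'I_k -> M) (z z' : 'I_(Dsum d) -> M) : H t (pair_val b z') =
  H t (pair_val b z) + \sum_(i < r) H t (block_vec (subv (blk z' i) (blk z i))).
Proof. by rewrite -lform_sum // -(pair_val_blocks b) lformB // subrKC. Qed.

(* Moving every block along its own kernel line fixes the near forms, and short
   moves do not change the side on which a far form lies. *)
Lemma kernel_lines_grid (b : 'I_k -> M) (z : 'I_(Dsum d) -> M) : I b -> E b z ->
  (forall i, exists phi, kernel_line H (near (pattern (pair_val b z))) (block_seq i) phi) ->
  ~ inf_free (E b) 0.
Proof.
move=> Ib Ebz kers; set D := near _ in kers; set v := pair_val b z in D kers.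
have {kers} ker i : {phi | kernel_line H D (block_seq i) phi}.
  exact: constructive_indefinite_description.
pose phi i := sval (ker i).
have kphi i : kernel_line H D (block_seq i) (phi i) by rewrite /phi; case: (ker i).
have [e0 e0_gt0] : exists e : M, 0 < e.
  by have [_ _ [j [y /neq0_ex_pos[e e_gt0 _]]] _] := kphi (Ordinal r_gt0); exists e.
(* One [del] for all forms: near forms do not move at all, and for a far form the allowed move [e]
   is shared among the blocks. *)
have [|t|del del_gt0 Hdel] := @ex_uniform_small T (fun t del => forall y : 'I_r -> M,
    (forall i, 0 < y i /\ y i < del) ->
    agree m (H t v) (H t v + \sum_i H t ((phi i)^~ (y i)))) e0 e0_gt0.
- move=> t del del' le Hd y Hy; apply: Hd => i; have [h1 h2] := Hy i.
  by split=> //; exact: lt_le_trans le.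
- have [tD|ntD] := boolP (t \in D).
    exists e0 => // y _; rewrite big1 ?addr0; first by left.
    by move=> i _; have [_ _ _ ->] := kphi i.
  have [e e_gt0 He] := agree_perturb (not_near ntD).
  have [e' e'_gt0 He'] := @ex_div r e e_gt0.
  have [|i|del del_gt0 Hdel] := @ex_uniform_small 'I_r (fun i del => forall y,
      0 < y -> y < del -> - e' < H t ((phi i)^~ y) /\ H t ((phi i)^~ y) < e') e0 e0_gt0.
  + by move=> i del del' le Hd y y_gt0 lty; apply: Hd => //; exact: lt_le_trans le.
  + have [ephi _ _ _] := kphi i; exact: endo_small (lform_line (lH t) ephi) e'_gt0.
  exists del => // y Hy; have [|h1 h2] := He' (fun i => H t ((phi i)^~ (y i))); last exact: He.
  by move=> i; have [h1 h2] := Hy i; exact: Hdel.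
(* Side [i] of the grid is a short segment of the kernel line through [blk z i]. *)
apply; exists (fun i u => exists y : M, (0 < y /\ y < del) /\
  u = fun l => blk z i l + phi i (k + off d i + l)%N y); split=> [i|].
  move=> [n [s defs]]; have [ephi sphi [j [y0 nephi]] _] := kphi i.
  have [Y injY HY] := infinite_interval del_gt0.
  have jblk : j \in block_seq i by apply/negPn/negP => nj; rewrite sphi ?eqxx in nephi.
  have [l eqj] : exists l : 'I_(d i), j = (k + off d i + l)%N.
    move: jblk; rewrite mem_iota => /andP[le lt].
    have lt' : (j - (k + off d i) < d i)%N by rewrite ltn_subLR.
    by exists (Ordinal lt'); rewrite /= subnKC.
  have injphi y y' : phi i j y = phi i j y' -> y = y'.
    move=> eqphi; apply/eqP; rewrite -subr_eq0; apply/negPn/negP => ne.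
    have phi0 : phi i j (y - y') = 0 by rewrite endoB // eqphi subrr.
    by rewrite (endo_eq0 (ephi j) phi0 ne) eqxx in nephi.
  have idx q : {c | s c = fun l => blk z i l + phi i (k + off d i + l)%N (Y q)}.
    by apply: constructive_indefinite_description; apply/defs; exists (Y q).
  (* Distinct parameters give distinct points, so [n.+1] of them overflow an enumeration of length
     [n]. *)
  have inj_idx : injective (fun q : 'I_n.+1 => sval (idx q)).
    move=> q q' eqi; apply: val_inj; apply: injY; apply: injphi.
    have := svalP (idx q); rewrite eqi (svalP (idx q')) => /(congr1 (fun u => u l)).
    by rewrite -eqj => /addrI.
  by have := leq_card _ inj_idx; rewrite !card_ord ltnn.
(* Every set is [0]-distant; what remains is that the grid lies in [E b]. *)
split=> [i x y _ _ nexy|z' Hz'].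
  case: (lt_or_le 0 (normv (subv x y))) => // /normv_le[_ eq0]; case: nexy.
  apply: functional_extensionality => l; have [h1 h2] := eq0 l.
  apply/eqP; rewrite -subr_eq0 eq_le; apply/andP; split; first exact: h2.
  by move: h1; rewrite oppr0.
have y_ i : {y : M | (0 < y /\ y < del) /\
    blk z' i = fun l => blk z i l + phi i (k + off d i + l)%N y}.
  exact: constructive_indefinite_description.
apply: (HE Ib _ Ebz) => t; rewrite (form_blocks t b z z').
have -> : \sum_(i < r) H t (block_vec (subv (blk z' i) (blk z i))) =
    \sum_i H t ((phi i)^~ (sval (y_ i))).
  apply: eq_bigr => i _; have [_ sphi _ _] := kphi i.
  rewrite -(block_vecK (sphi (sval (y_ i)))); congr (H t _); congr block_vec.
  apply: functional_extensionality => l; rewrite /subv.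
  by case: (y_ i) => y [_ eqy] /=; rewrite eqy addrC addKr.
by apply: Hdel => i; have [] := svalP (y_ i).
Qed.

(** Without an infinite grid, some block has no kernel line for the near forms. A displacement
    within that block and the pattern changes the near forms by at most [m + m], hence is
    bounded. *)
Lemma fiber_bounded : exists2 mstar : M, 0 <= mstar &
  forall (b : 'I_k -> M) (z : 'I_(Dsum d) -> M), I b -> E b z -> inf_free (E b) 0 ->
  exists i : 'I_r, forall z1 z2 : 'I_(Dsum d) -> M,
    pattern (pair_val b z1) = pattern (pair_val b z) ->
    pattern (pair_val b z2) = pattern (pair_val b z) ->
    (forall l, l != i -> blk z1 l = blk z2 l) ->
    normv (subv (blk z1 i) (blk z2 i)) <= mstar.
Proof.
have mm_ge0 : 0 <= m + m by rewrite -[0]addr0 leD.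
(* The bound is taken over all pairs of a set of forms and a block, finitely many, and so does not
   depend on [b]. *)
have [||ms ms_ge0 Hms] := @ex_uniform ({set T} * 'I_r)%type (fun Di ms =>
    (exists phi, kernel_line H Di.1 (block_seq Di.2) phi) \/
    (forall v, supported (block_seq Di.2) v ->
       (forall t, t \in Di.1 -> within (m + m) (H t v)) -> forall j, within ms (v j))).
- move=> Di n n' le [ker|bnd]; first by left.
  by right=> v sv Hv j; apply: within_le le _; exact: bnd.
- move=> [D i] /=; case: (kernel_or_bounded D lH (iota_uniq (k + off d i) (d i)) mm_ge0).
    by move=> ker; exists 0; left.
  by move=> [n Hn]; exists n; right.
exists ms => // b z Ib Ebz infree.
have [i nker] : exists i, ~ exists phi,
    kernel_line H (near (pattern (pair_val b z))) (block_seq i) phi.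
  apply: NNPP => noi; apply: (kernel_lines_grid Ib Ebz _ infree) => i.
  by apply: NNPP => nker; apply: noi; exists i.
exists i => z1 z2 pat1 pat2 eqblk.
have [ker|bnd] := Hms (near (pattern (pair_val b z)), i); first by case: nker.
set u := subv _ _; have eqH t : H t (block_vec u) = H t (pair_val b z1) - H t (pair_val b z2).
  rewrite (form_blocks t b z2 z1) [in RHS]addrC addKr (bigD1 i) //= big1 ?addr0 // => l nel.
  rewrite (eqblk l nel) (_ : block_vec _ = fun=> 0) ?lform_0 //.
  apply: functional_extensionality => j; rewrite /block_vec; case: ifP => // _.
  by rewrite /getn; case: insubP => // o _ _; rewrite /subv subrr.
apply/normv_le; split=> // l.
have -> : u l = block_vec u (k + off d i + l) by rewrite /block_vec leq_addr addKn getn_lt.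
apply: bnd => [|t tD]; first exact: block_vec_supported.
rewrite eqH; apply: withinD; last apply: withinN.
  by apply/mem_near; rewrite pat1.
by apply/mem_near; rewrite pat2.
Qed.

End Blocks.

End OrderedGroup.

(** * Counting grid points and the uniform linear bound *)

(** Forgetting coordinate [i] embeds [B] in the product of the other sides, whose size is one
    summand of [delta n]. *)
Lemma card_le_delta r (n : 'I_r -> nat) (A : finType) (B : {set A}) (i : 'I_r)
    (idx : A -> 'I_r -> nat) :
  (forall a l, (idx a l < n l)%N) ->
  {in B &, forall a a', (forall l, l != i -> idx a l = idx a' l) -> a = a'} ->
  (#|B| <= delta n)%N.
Proof.
move=> lt_idx inj_idx; pose K := (\max_l n l)%N.
have lt_K a l : (idx a l < K.+1)%N.
  by rewrite ltnS; apply: leq_trans (ltnW (lt_idx a l)) _; exact: leq_bigmax.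
(* The forgotten coordinate gets the default [ord0], which places [g a] in a family supported off
   [i]. *)
pose g a : {ffun 'I_r -> 'I_K.+1} := [ffun l => if l == i then ord0 else inord (idx a l)].
have inj_g : {in B &, injective g}.
  move=> a a' aB a'B /ffunP eqg; apply: inj_idx => // l nel.
  have := congr1 val (eqg l); rewrite !ffunE (negbTE nel) /= !inordK //.
pose F l := [pred j : 'I_K.+1 | (j < n l)%N].
have card_F l : (#|F l| <= n l)%N.
  have inj_v : {in F l &, injective (fun j : 'I_K.+1 => nat_of_ord j)} by move=> ? ? _ _ /val_inj.
  rewrite -(size_iota 0 (n l)) cardE -(size_map (@nat_of_ord K.+1)).
  apply: uniq_leq_size; first by rewrite map_inj_uniq ?enum_uniq //; exact: val_inj.
  by move=> x /mapP[j + ->]; rewrite mem_enum mem_iota.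
rewrite -(card_in_imset inj_g).
apply: (@leq_trans #|pfamily (ord0 : 'I_K.+1) (mem [set~ i]) F|).
  apply/subset_leq_card/subsetP => _ /imsetP[a aB ->]; apply/pfamilyP; split.
    by apply/subsetP => l; rewrite !inE ffunE; case: (l == i).
  by move=> l; rewrite !inE ffunE => /negbTE ->; rewrite inordK.
rewrite card_pfamily foldrE big_map big_enum /=.
apply: (@leq_trans (\prod_(l in [set~ i]) n l)%N); first by apply: leq_prod => l _; exact: card_F.
rewrite /delta (bigD1 [set~ i]) /=; first exact: leq_addr.
by rewrite cardsC1 card_ord.
Qed.

Theorem theoremA (M : porderZmodType)
    (P : forall n, (('I_n -> M) -> Prop) -> Prop)
    (hexp : expansion_of_ordered_group P)
    (homin : o_minimal P)
    (hsb : semibounded P)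
    (r : nat) (hr : (0 < r)%N) (d : 'I_r -> nat) (hd : forall i, (0 < d i)%N)
    (k : nat) (I : ('I_k -> M) -> Prop)
    (E : ('I_k -> M) -> ('I_(Dsum d) -> M) -> Prop)
    (hfam : definable_family P I E) :
  exists alpha : R, Rlt R0 alpha /\
    exists mb : ('I_k -> M) -> M,
      forall b, I b -> 0 <= mb b /\ Zar_inf (E b) alpha (mb b).
Proof.
have [og [P_lt [P_add _]]] := hexp.
have [_ defE] := hfam; have [f [wff [p defS]]] := hsb _ _ defE.
(* The forms and [m] come from the formula of the whole family, so they are the same for all [b]. *)
have [T [H [m [m_ge0 lH HS]]]] := coarse_sat og P_lt P_add homin wff.
have defV (b : 'I_k -> M) (z : 'I_(Dsum d) -> M) : sat (pair_val p b z) f <-> I b /\ E b z.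
  rewrite /pair_val -defS.
  have -> : (fun j => match split (lshift (Dsum d) j) with inl i => b i | inr i => z i end) = b.
    by apply: functional_extensionality => j; rewrite -[lshift _ _]/(unsplit (inl j)) unsplitK.
  have -> // : (fun j => match split (rshift k j) with inl i => b i | inr i => z i end) = z.
  by apply: functional_extensionality => j; rewrite -[rshift _ _]/(unsplit (inr j)) unsplitK.
have HE (b : 'I_k -> M) (z z' : 'I_(Dsum d) -> M) : I b ->
    (forall t, agree m (H t (pair_val p b z)) (H t (pair_val p b z'))) -> E b z -> E b z'.
  by move=> Ib agr Ebz; have /defV[] := HS _ _ agr ((defV b z).2 (conj Ib Ebz)).
have [ms ms_ge0 Hms] := fiber_bounded og P_lt P_add homin m_ge0 lH HE hr.
(* The number of patterns, plus one so that positivity is immediate. *)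
exists (INR #|{ffun T -> option bool}|.+1); split; first exact/lt_0_INR/PeanoNat.Nat.lt_0_succ.
exists (fun b => if excluded_middle_informative (inf_free (E b) 0) then ms else 0) => b Ib.
case: excluded_middle_informative => [infree|notfree]; last by split=> // /notfree.
split=> // _ n s inj_s dist N pts inj_pts Hpts.
have idx a i : {j | blk (pts a) (i:=i) = s i j}.
  by apply: constructive_indefinite_description; have [_] := Hpts a; apply.
pose pat a := pattern H m (pair_val p b (pts a)).
have bound sigma : (\sum_(a | pat a == sigma) 1 <= delta n)%N.
  rewrite sum1dep_card.
  case: (pickP [pred a | pat a == sigma]) => [a0 /= /eqP pat0|none]; last first.
    by rewrite (_ : [set a | pat a == sigma] = set0) ?cards0 //; apply/setP => a; rewrite !inE; exact: none.
  have [i Hi] := Hms b (pts a0) Ib (Hpts a0).1 infree.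
  apply: (@card_le_delta r n _ _ i (fun a l => val (sval (idx a l)))) => [a l|a a'].
    exact: ltn_ord.
  rewrite !inE => /eqP pata /eqP pata' eq_idx; apply: inj_pts; apply: blk_inj => l.
  have eqb l' : l' != i -> blk (pts a) (i:=l') = blk (pts a') (i:=l').
    move=> nel; rewrite (svalP (idx a l')) (svalP (idx a' l')); congr (s l' _).
    by apply: val_inj; exact: eq_idx.
  have [->|] := eqVneq l i; last exact: eqb.
  (* Distinct blocks [i] would be at distance at most [ms], against the [ms]-distance of side
     [i]. *)
  apply: NNPP => ne.
  have /le_not_lt : normv (subv (blk (pts a) (i:=i)) (blk (pts a') (i:=i))) <= ms.
    by apply: Hi eqb; rewrite -/(pat _) ?pata ?pata' -/(pat _) pat0.
  apply; apply: dist ne; [exists (sval (idx a i))|exists (sval (idx a' i))].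
    by rewrite -(svalP (idx a i)).
  by rewrite -(svalP (idx a' i)).
have leN : (N <= #|{ffun T -> option bool}|.+1 * delta n)%N.
  rewrite -[N]card_ord -sum1_card (partition_big pat predT) //=.
  apply: leq_trans (leq_sum _ (fun sigma _ => bound sigma)) _.
  by rewrite sum_nat_const leq_mul2r leqnSn orbT.
by rewrite -mult_INR; apply: le_INR; apply/ssrnat.leP.
Qed.
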